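(* Under the standing hypotheses (H1)–(H6) below, the deficiency indices of the minimal relation $T_{\min}$ are equal and at most two: $$n(T_{\min}):=\dim\operatorname{ran}(T_{\min}-\mathrm{i})^\perp=\dim\operatorname{ran}(T_{\min}+\mathrm{i})^\perp\le 2.$$
   Context: Let $-\infty\le a<b\le\infty$ and $\varrho,\varsigma,\chi$ locally finite Borel measures on $(a,b)$ with: (H1) $\varrho$ positive; (H2) $\chi$ real-valued; (H3) $\varsigma$ real-valued with $\operatorname{supp}\varsigma=(a,b)$; (H4) $\varsigma(\{x\})\chi(\{x\})=\varsigma(\{x\})\varrho(\{x\})=0$ for all $x$; (H5) for every gap $(\alpha,\beta)$ of $\operatorname{supp}\varrho$ (open interval in the complement with $\alpha,\beta\in\operatorname{supp}\varrho$) and every $f\in\mathfrak{D}_\tau$ with $f(\alpha-)=f(\beta+)=0$ one has $f=0$ on $(\alpha,\beta)$; (H6) $\operatorname{supp}\varrho$ has more than one point. Notation: $\int_c^x h\,d\mu=\int_{[c,x)}h\,d\mu$ ($x>c$), $0$ ($x=c$), $-\int_{[x,c)}h\,d\mu$ ($x<c$); $AC_{loc}((a,b);\mu)$: functions $f(x)=f(c)+\int_c^x h\,d\mu$, $h=\frac{df}{d\mu}\in L^1_{loc}$. $\mathfrak{D}_\tau$: $f\in AC_{loc}((a,b);\varsigma)$ for which there is $F\in AC_{loc}((a,b);\varrho)$ with $F=-\frac{df}{d\varsigma}+\int_c^{\cdot}f\,d\chi$ $|\varsigma|$-a.e.; $\tau f:=\frac{dF}{d\varrho}$. In $L^2((a,b);\varrho)$: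 $T_{\max}=\{(f,\tau f): f\in\mathfrak{D}_\tau,\ f,\tau f\in L^2\}$, $T_0=\{(f,\tau f)\in T_{\max}: f\text{ has compact support in }(a,b)\}$, $T_{\min}=\overline{T_0}$. For a linear relation $T$ and $z\in\mathbb{C}$, $T-z=\{(f,g-zf):(f,g)\in T\}$ and $\operatorname{ran}(T)=\{g:\exists f,(f,g)\in T\}$. *)

(* Defs.v *)
(* Measure-valued Sturm--Liouville relations:
   deficiency indices of T_min (Theorem 4.9). *)
From HB Require Import structures.
From mathcomp Require Import all_boot all_order all_algebra.
From mathcomp Require Import all_classical all_reals all_analysis.
From mathcomp Require Import complex.
Set Implicit Arguments. Unset Strict Implicit. Unset Printing Implicit Defensive.
Import Order.TTheory GRing.Theory Num.Theory.
Local Open Scope ring_scope.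
Local Open Scope classical_set_scope.

Section SL.
Context {R : realType}.
Local Notation C := R[i].
Local Notation Re := (@complex.Re R).
Local Notation Im := (@complex.Im R).
Implicit Types (mu rho mp mm sp sm cp cm : {measure set R -> \bar R})
  (a b : \bar R) (f g h F : R -> C).

(** the open interval (a,b), -oo <= a < b <= +oo *)
Definition oitv a b : set R := [set x | (a < x%:E)%E /\ (x%:E < b)%E].
(** [c,d] and [c,d) *)
Definition citv (c d : R) : set R := [set x | (c <= x <= d)%R].
Definition coitv (c d : R) : set R := [set x | (c <= x < d)%R].

(** integral of a complex function over A w.r.t. a positive measure:
    \int_A h dmu = \int_A Re h dmu + i \int_A Im h dmu *)
Definition cint mu (A : set R) h : C :=
  Complex (Rintegral mu A (Re \o h)) (Rintegral mu A (Im \o h)).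

(** the paper's \int_c^x h dmu convention *)
Definition intc mu (c x : R) h : C :=
  if (c < x)%R then cint mu (coitv c x) h
  else if (x < c)%R then - cint mu (coitv x c) h else 0.

(** a real-valued (signed) measure is given by its Jordan decomposition
    mp - mm (mp, mm positive, mutually singular); then |.| = mp + mm *)
Definition sintc mp mm (c x : R) h : C := intc mp c x h - intc mm c x h.

(** positive locally finite Borel measure on (a,b) (extended by 0 to R) *)
Definition locfin a b mu : Prop :=
  mu (~` oitv a b) = 0%E /\
  forall c d, oitv a b c -> oitv a b d -> (mu (citv c d) < +oo)%E.

(** real-valued locally finite Borel measure on (a,b), Jordan decomposition *)
Definition real_lfmeasure a b mp mm : Prop :=
  locfin a b mp /\ locfin a b mm /\
  exists P : set R, measurable P /\ mp (~` P) = 0%E /\ mm P = 0%E.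

(** value mu({x}) of the signed measure mp - mm at a point *)
Definition ptmass mp mm (x : R) : R := fine (mp [set x]) - fine (mm [set x]).

(** supports (relative to (a,b)) *)
Definition in_supp mu (x : R) : Prop :=
  forall e : R, 0 < e -> (0 < mu [set y | (x - e < y < x + e)%R])%E.
Definition in_supp_abs mp mm (x : R) : Prop :=
  forall e : R, 0 < e ->
    (0 < mp [set y | (x - e < y < x + e)%R] + mm [set y | (x - e < y < x + e)%R])%E.

(** h in L^1_loc((a,b); mu) *)
Definition locint a b mu h : Prop :=
  forall c d, oitv a b c -> oitv a b d ->
    mu.-integrable (citv c d) (EFin \o (Re \o h)) /\
    mu.-integrable (citv c d) (EFin \o (Im \o h)).

(** f in AC_loc((a,b); mu) with df/dmu = h, mu positive *)
Definition ACloc_pos a b mu f h : Prop :=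
  locint a b mu h /\
  exists c, oitv a b c /\ forall x, oitv a b x -> f x = f c + intc mu c x h.

(** f in AC_loc((a,b); mp - mm) with df/d(mp-mm) = h *)
Definition ACloc a b mp mm f h : Prop :=
  locint a b mp h /\ locint a b mm h /\
  exists c, oitv a b c /\ forall x, oitv a b x -> f x = f c + sintc mp mm c x h.

(** |mp - mm|-almost everywhere on (a,b) *)
Definition sae a b mp mm (P : R -> Prop) : Prop :=
  {ae mp, forall x, oitv a b x -> P x} /\ {ae mm, forall x, oitv a b x -> P x}.

(** f \in D_tau and g is (a representative of) tau f;
    varsigma = sp - sm, chi = cp - cm *)
Definition Dtau a b rho sp sm cp cm f g : Prop :=
  exists h F, ACloc a b sp sm f h /\ ACloc_pos a b rho F g /\
  exists c, oitv a b c /\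
    sae a b sp sm (fun x => F x = - h x + sintc cp cm c x f).

Definition sqn (z : C) : R := Re z ^+ 2 + Im z ^+ 2.

(** membership in L^2((a,b); rho) *)
Definition L2 a b rho f : Prop :=
  measurable_fun (oitv a b) (Re \o f) /\ measurable_fun (oitv a b) (Im \o f) /\
  rho.-integrable (oitv a b) (EFin \o (sqn \o f)).

(** equality in L^2((a,b); rho) *)
Definition aeq a b rho f g : Prop := {ae rho, forall x, oitv a b x -> f x = g x}.

(** (f, g) in T_max (as elements of L^2 x L^2) *)
Definition Tmax a b rho sp sm cp cm f g : Prop :=
  L2 a b rho f /\ L2 a b rho g /\
  exists f0 g0, Dtau a b rho sp sm cp cm f0 g0 /\
    aeq a b rho f f0 /\ aeq a b rho g g0.

(** (f, g) in T_0 *)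
Definition T0 a b rho sp sm cp cm f g : Prop :=
  L2 a b rho f /\ L2 a b rho g /\
  exists f0 g0, Dtau a b rho sp sm cp cm f0 g0 /\
    (exists c d, oitv a b c /\ oitv a b d /\
       forall x, oitv a b x -> ~ citv c d x -> f0 x = 0) /\
    aeq a b rho f f0 /\ aeq a b rho g g0.

(** T_min = closure of T_0 in L^2 x L^2 *)
Definition Tmin a b rho sp sm cp cm f g : Prop :=
  L2 a b rho f /\ L2 a b rho g /\
  forall e : R, 0 < e -> exists f' g', T0 a b rho sp sm cp cm f' g' /\
    (\int[rho]_(x in oitv a b) (sqn (f x - f' x))%:E
     + \int[rho]_(x in oitv a b) (sqn (g x - g' x))%:E < e%:E)%E.

(** ran(T_min - z)^perp in L^2((a,b); rho), inner product <u,v> = \int u v^* drho *)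
Definition defect a b rho sp sm cp cm (z : C) (u : R -> C) : Prop :=
  L2 a b rho u /\
  forall f g, Tmin a b rho sp sm cp cm f g ->
    cint rho (oitv a b) (fun x => u x * (g x - z * f x)^*) = 0.

(** the subspace S of L^2((a,b); rho) has (linear) dimension n *)
Definition L2dim a b rho (S : (R -> C) -> Prop) (n : nat) : Prop :=
  exists e : 'I_n -> R -> C,
    (forall i, S (e i)) /\
    (forall k : 'I_n -> C,
       aeq a b rho (fun x => \sum_(i < n) k i * e i x) (fun=> 0) ->
       forall i, k i = 0) /\
    (forall u, S u -> exists k : 'I_n -> C,
       aeq a b rho u (fun x => \sum_(i < n) k i * e i x)).

End SL.

(* Main.v *)
(* Let [u0, u1, u2] be in the defect space at [z] and let [[c, d)] be a compact
   subinterval. Solving [(tau - z) f = u_j 1_[c,d)] forward from zero data at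
   [c], by Picard iteration, and choosing a nonzero [k] in [C^3] that kills the
   two end values of [sum_j k_j f_j] and of its quasi-derivative at [d], one gets
   a compactly supported solution, so [sum_j k_j u_j 1_[c,d)] is in
   [ran (T0 - z)] and orthogonal to [sum_j k_j u_j]: the [u_j] are linearly
   dependent on [[c, d)]. The spaces of such [k] decrease as [[c, d)] grows, so
   a common nonzero [k] exists and the defect space has dimension at most 2. Its
   dimensions at [i] and [-i] agree by complex conjugation.

   With integrals over [[c, x)] the forward equation is explicit across an atom;
   convergence of the Picard series rests on
   [I_(n+1) = int_[c,x) I_n dmu <= mu([c,x))^(n+1) / (n+1)!]. *)
Require Import Defs.
From HB Require Import structures.
From mathcomp Require Import all_boot all_order all_algebra.
From mathcomp Require Import all_classical all_reals all_analysis.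
From mathcomp Require Import complex.
From mathcomp Require Import measurable_realfun ring lra.
Import Order.TTheory GRing.Theory Num.Theory.
Local Open Scope ring_scope.
Local Open Scope classical_set_scope.

(** * Iterated integrals over half-open intervals against a finite measure *)

Section primitives.
Context {R : realType}.
Implicit Types mu nu : {finite_measure set R -> \bar R}.

(** Joint measurability in endpoint and variable is what Tonelli's theorem needs to make primitives
    measurable in their upper endpoint. *)
Lemma measurable_primitive_kernel (c : R) (g : R -> \bar R) :
  measurable_fun setT g ->
  measurable_fun setT (fun xy : R * R => (g \_ `[c, xy.1[) xy.2).
Proof.
move=> mg; rewrite (_ : (fun _ => _) = (fun xy : R * R =>
    if (c <= xy.2) && (xy.2 < xy.1) then g xy.2 else 0%E)); last first.
  by apply/funext => -[x y]; rewrite /patch mem_setE in_itv.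
apply: measurable_fun_ifT => //.
- by apply: measurable_and; [exact: measurable_fun_ler|exact: measurable_fun_ltr].
- exact: measurableT_comp.
Qed.

Lemma measurable_ge0_primitive nu (c : R) (g : R -> \bar R) :
  measurable_fun setT g -> (forall y, (0 <= g y)%E) ->
  measurable_fun setT (fun x => \int[nu]_(y in `[c, x[) g y)%E.
Proof.
move=> mg g0; under eq_fun do rewrite integral_mkcond.
apply: (measurable_fun_fubini_tonelli_F (fun xy : R * R => (g \_ `[c, xy.1[) xy.2)).
  exact: measurable_primitive_kernel.
by move=> xy; exact: erestrict_ge0.
Qed.

(** This mass is the inner integral left by the exchange of order in [primitive_by_parts_le]; it is
    a section integral of the indicator of y < s < x. *)
Lemma measurable_measure_itv_right mu (x : R) :
  measurable_fun setT (fun y : R => mu `]y, x[).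
Proof.
pose f (ys : R * R) : \bar R := if (ys.1 < ys.2) && (ys.2 < x) then 1%E else 0%E.
rewrite (_ : (fun _ => _) = (fun y => \int[mu]_s f (y, s))%E); last first.
  apply/funext => y; rewrite -[in LHS](setIT `]y, x[) -integral_indic//.
  apply: eq_integral => s _; rewrite /f/= indicE mem_setE in_itv/=.
  by case: ifPn.
apply: (measurable_fun_fubini_tonelli_F f); last by move=> ys; rewrite /f; case: ifPn.
apply: measurable_fun_ifT => //.
by apply: measurable_and; exact: measurable_fun_ltr.
Qed.

(* Split [{s < x} x {y < x}] along the diagonal and discard the diagonal. *)
Lemma primitive_by_parts_le mu (c : R) (g : R -> \bar R) (x : R) :
  measurable_fun setT g -> (forall y, (0 <= g y)%E) ->
  (\int[mu]_(y in `[c, x[) (mu `[c, y[ * g y)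
   + \int[mu]_(s in `[c, x[) \int[mu]_(y in `[c, s[) g y
   <= mu `[c, x[ * \int[mu]_(y in `[c, x[) g y)%E.
Proof.
move=> mg g0.
have mM : measurable_fun setT (fun y : R => mu `[c, y[).
  rewrite (_ : (fun _ => _) = (fun y => \int[mu]_(s in `[c, y[) cst 1%E s)%E).
    exact: measurable_ge0_primitive.
  by apply/funext => y; rewrite integral_cst// mul1e.
(* Both sides integrate [g y] over c <= y < s < x; integrating s first leaves the mass of (y, x). *)
have swap : (\int[mu]_(s in `[c, x[) \int[mu]_(y in `[c, s[) g y =
    \int[mu]_(y in `[c, x[) (mu `]y, x[ * g y))%E.
  rewrite integral_mkcond [RHS]integral_mkcond.
  pose f (sy : R * R) := ((g \_ `[c, sy.1[) sy.2 * (\1_`[c, x[ sy.1)%:E)%E.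
  have mf : measurable_fun setT f.
    apply: emeasurable_funM; first exact: measurable_primitive_kernel.
    by apply/measurable_EFinP; apply: measurableT_comp => //.
  have f0 sy : (0 <= f sy)%E by rewrite mule_ge0// ?erestrict_ge0// lee_fin.
  transitivity (\int[mu]_s \int[mu]_y f (s, y))%E.
    apply: eq_integral => s _; rewrite /f/= /patch indicE.
    case: ifPn => xs.
      rewrite integral_mkcond; apply: eq_integral => y _ /=.
      by rewrite mule1.
    by rewrite integral0_eq// => y _; rewrite mule0.
  rewrite fubini_tonelli//; apply: eq_integral => y _.
  transitivity (\int[mu]_s ((\1_`]y, x[ s)%:E * (g \_ `[c, x[) y))%E.
    apply: eq_integral => s _; rewrite /f/= /patch !indicE !mem_setE !in_itv/=.
    have [cy|cy]/= := leP c y; last by rewrite mul0e mule0.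
    have [ys|ys]/= := ltP y s; last by rewrite !mul0e.
    have [sx|sx]/= := ltP s x; last by rewrite andbF mule0 mul0e.
    by rewrite (le_trans cy (ltW ys)) (lt_trans ys sx) mule1 mul1e.
  rewrite ge0_integralZr//; last 2 first.
  - by apply/measurable_EFinP; exact: measurable_indic.
  - exact: erestrict_ge0.
  rewrite integral_indic// setIT /patch.
  by case: ifPn => //; rewrite mule0.
have mMr := measurable_measure_itv_right mu x.
rewrite swap -ge0_integralD//=; last 4 first.
- by move=> y _; rewrite mule_ge0.
- by apply: measurable_funTS; exact: emeasurable_funM.
- by move=> y _; rewrite mule_ge0.
- by apply: measurable_funTS; exact: emeasurable_funM.
rewrite -ge0_integralZl//; last exact: measurable_funTS.
apply: ge0_le_integral => //.
- by move=> y _; rewrite adde_ge0// mule_ge0.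
- by apply: measurable_funTS; apply: emeasurable_funD; exact: emeasurable_funM.
- by apply: measurable_funTS; exact: emeasurable_funM.
move=> y; rewrite /= in_itv/= => /andP[cy yx].
(* [c, y) and (y, x) are disjoint subsets of [c, x) that omit only y, so at most an atom at y is
   lost. *)
rewrite -ge0_muleDl// lee_wpmul2r//.
rewrite -measureU//; last first.
  apply/seteqP; split => // s /= [].
  by rewrite !in_itv/= => /andP[_ sy] /andP[ys _]; rewrite -falseE -(lt_asym s y) sy.
apply: le_measure; rewrite ?inE//; first exact: measurableU.
move=> s [] /=; rewrite !in_itv/= => /andP[h1 h2].
  by rewrite h1 (lt_trans h2 yx).
by rewrite h2 (le_trans cy (ltW h1)).
Qed.

(** The mass, under the n-fold product of [mu], of the simplex c <= y_1 < ... < y_n < x. *)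
Fixpoint iterated_mass mu (c : R) n (x : R) : \bar R :=
  if n is n'.+1 then (\int[mu]_(y in `[c, x[) iterated_mass mu c n' y)%E else 1%E.

Lemma iterated_mass_ge0 mu c n x : (0 <= iterated_mass mu c n x)%E.
Proof. by elim: n x => //= n IH x; exact: integral_ge0. Qed.

Lemma measurable_iterated_mass mu c n : measurable_fun setT (iterated_mass mu c n).
Proof.
elim: n => [|n IH]; first exact: measurable_cst.
by apply: measurable_ge0_primitive => // y; exact: iterated_mass_ge0.
Qed.

(** Write I_n for [iterated_mass mu c n]. By induction: integrating the bound for n over [c, x) puts
    n+1 copies of I_(n+2) below the first term of [primitive_by_parts_le] for g = I_n, and the
    second term there is one more copy. *)
Lemma iterated_mass_step mu c n x :
  (n.+1%:R%:E * iterated_mass mu c n.+1 x <= mu `[c, x[ * iterated_mass mu c n x)%E.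
Proof.
have I0 := iterated_mass_ge0 mu c; have mI := measurable_iterated_mass mu c.
elim: n x => [|n IH] x; first by rewrite /= integral_cst// !mul1e mule1.
apply: le_trans (primitive_by_parts_le mu c (iterated_mass mu c n) x (mI n) (I0 n)).
rewrite -natr1 EFinD ge0_muleDl// mul1e leeD2r//.
rewrite -ge0_integralZl//; last 2 first.
- by apply: measurable_funTS; exact: (mI n.+1).
- by move=> y _; exact: (I0 n.+1).
apply: ge0_le_integral => //.
- by move=> y _; apply: mule_ge0; [rewrite lee_fin|exact: (I0 n.+1)].
- by apply: measurable_funTS; apply: emeasurable_funM => //; exact: (mI n.+1).
- apply: measurable_funTS; apply: emeasurable_funM => //.
  rewrite (_ : (fun _ => _) = iterated_mass mu c 1) //.
  by apply/funext => y /=; rewrite integral_cst// mul1e.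
- by move=> y _; exact: IH.
Qed.

(** Iteration of [iterated_mass_step], with the mass of [c, x) replaced by the total mass. The bound
    is uniform in x and is a term of the exponential series, hence summable. *)
Lemma iterated_mass_le mu c n x :
  (iterated_mass mu c n x <= (exp_coeff (fine (mu setT)) n)%:E)%E.
Proof.
elim: n => [|n IH]; first by rewrite /exp_coeff/= expr0 fact0 divr1.
have m0 : 0 <= fine (mu setT) by rewrite fine_ge0.
have := iterated_mass_step mu c n x; rewrite -lee_pdivlMl// => /le_trans; apply.
rewrite lee_pdivrMl//.
have -> : (n.+1%:R%:E * (exp_coeff (fine (mu setT)) n.+1)%:E =
           mu setT * (exp_coeff (fine (mu setT)) n)%:E)%E.
  rewrite -[mu setT in RHS]fineK ?fin_num_measure// -!EFinM; congr EFin.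
  rewrite /exp_coeff/= exprS factS natrM; field.
  by rewrite nat1r !pnatr_eq0 -lt0n fact_gt0.
apply: lee_pmul => //; first exact: iterated_mass_ge0.
by apply: le_measure; rewrite ?inE.
Qed.

End primitives.

(** * Picard iteration for linear Volterra systems with several measures *)

Section volterra.
Import numFieldNormedType.Exports.
Context {R : realType} {J L : Type}.
Implicit Types (nu : {finite_measure set R -> \bar R}) (f : R -> R) (U V : J -> R -> R).

Definition bounded_measurable U :=
  (forall j, measurable_fun setT (U j)) /\ exists B, forall j x, `|U j x| <= B.

Lemma integrable_of_bounded nu f B (D : set R) : measurable D ->
  measurable_fun setT f -> (forall x, `|f x| <= B) -> nu.-integrable D (EFin \o f).
Proof.
move=> mD mf fB; apply: (@le_integrable _ _ _ _ _ _ _ (EFin \o cst B)) => //.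
- by apply/measurable_EFinP; exact: measurable_funTS.
- by move=> x _; rewrite lee_fin (le_trans (fB x))// ler_norm.
- exact: finite_measure_integrable_cst.
Qed.

Lemma measurable_primitive nu (c : R) f :
  measurable_fun setT f -> measurable_fun setT (fun x => \int[nu]_(y in `[c, x[) f y).
Proof.
move=> mf; apply: measurableT_comp => //.
under eq_fun do rewrite integralE.
by apply: emeasurable_funB; apply: measurable_ge0_primitive => //;
  [apply: measurable_funepos|apply: measurable_funeneg]; exact/measurable_EFinP.
Qed.

Variables (mu : {finite_measure set R -> \bar R}) (nu : L -> {finite_measure set R -> \bar R}).
Variables (c : R) (s : J -> seq (R * J * L)) (A : R).
Hypothesis nu_mu : forall l S, measurable S -> (nu l S <= mu S)%E.
Hypothesis sA : forall j, \sum_(t <- s j) `|t.1.1| <= A.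

(** An entry [(r, i, l)] of [s j] stands for the summand, in equation [j], of [r] times the integral
    of unknown [i] against [nu l]. *)
Definition volterra_op U : J -> R -> R :=
  fun j x => \sum_(t <- s j) t.1.1 * \int[nu t.2]_(y in `[c, x[) U t.1.2 y.

Lemma volterra_opB U V : bounded_measurable U -> bounded_measurable V ->
  forall j x, volterra_op U j x - volterra_op V j x =
    volterra_op (fun j x => U j x - V j x) j x.
Proof.
move=> [mU [B UB]] [mV [B' VB]] j x.
rewrite /volterra_op -sumrB; apply: eq_bigr => t _.
rewrite -mulrBr RintegralB//; exact: integrable_of_bounded.
Qed.

(** Since [nu l <= mu], nonnegative integrals against [nu l] are at most those against [mu], and
    integrating I_n over [c, x) gives I_(n+1); the coefficients cost a factor [A]. *)
Lemma volterra_op_iterated_mass U n K : bounded_measurable U -> 0 <= K ->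
  (forall j x, (`|U j x|%:E <= K%:E * iterated_mass mu c n x)%E) ->
  forall j x, (`|volterra_op U j x|%:E <= (A * K)%:E * iterated_mass mu c n.+1 x)%E.
Proof.
move=> [mU [B UB]] K0 UK j x.
have I0 : (0 <= iterated_mass mu c n.+1 x)%E := iterated_mass_ge0 mu c n.+1 x.
have Ifin : iterated_mass mu c n.+1 x \is a fin_num.
  by rewrite ge0_fin_numE// (le_lt_trans (iterated_mass_le _ _ _ _))// ltry.
have A0 : 0 <= A by apply: le_trans (sA j); apply: sumr_ge0.
have intU k l : (`|\int[nu l]_(y in `[c, x[) U k y| <= K * fine (iterated_mass mu c n.+1 x)).
  rewrite -lee_fin EFin_normr_Rintegral//; last exact: (@integrable_of_bounded _ _ B).
  apply: le_trans (le_abse_integral _ _ _) _ => //.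
    by apply/measurable_EFinP; exact: measurable_funTS.
  rewrite EFinM fineK// /= -/(iterated_mass _ _ _).
  have mI := measurable_iterated_mass mu c n.
  have I0n := iterated_mass_ge0 mu c n.
  rewrite -ge0_integralZl//; last exact: measurable_funTS.
  apply: (@le_trans _ _ (\int[nu l]_(y in `[c, x[) (K%:E * iterated_mass mu c n y))%E).
    apply: ge0_le_integral => //.
    - by apply/measurable_EFinP; apply: measurable_funTS; exact: measurableT_comp.
    - by apply: measurable_funTS; exact: emeasurable_funM.
  apply: ge0_le_measure_integral => //.
  - exact: nu_mu.
  - by move=> y; rewrite mule_ge0.
  - exact: emeasurable_funM.
rewrite -[iterated_mass _ _ _ _]fineK// -EFinM lee_fin.
apply: le_trans (ler_norm_sum _ _ _) _.
apply: (@le_trans _ _ (\sum_(t <- s j) `|t.1.1| * (K * fine (iterated_mass mu c n.+1 x)))).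
  by apply: ler_sum => t _; rewrite normrM ler_wpM2l.
by rewrite -mulr_suml -mulrA ler_wpM2r// mulr_ge0// fine_ge0.
Qed.

Variables (G : J -> R -> R).
Hypothesis bmG : bounded_measurable G.

Let m : R := fine (mu setT).

Let m_ge0 : 0 <= m. Proof. by rewrite fine_ge0. Qed.

Definition picard n : J -> R -> R :=
  iter n (fun U j x => G j x + volterra_op U j x) (fun _ _ => 0).

Let picardS n j x : picard n.+1 j x = G j x + volterra_op (picard n) j x.
Proof. by []. Qed.

(** Consecutive iterates differ by n applications of the operator to [G], each raising the order of
    the iterated mass by one. Boundedness is carried in the induction because linearity of the
    operator needs integrable arguments. The absolute value of [B] is nonnegative even when [J] is
    empty. *)
Lemma picard_step (B : R) : (forall j x, `|G j x| <= B) ->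
  forall n, bounded_measurable (picard n) /\ forall j x,
    (`|picard n.+1 j x - picard n j x|%:E
       <= (A ^+ n * `|B|)%:E * iterated_mass mu c n x)%E.
Proof.
move=> GB n.
have bmS k : bounded_measurable (picard k) -> bounded_measurable (picard k.+1) .
  move=> bmk; have [mk [Bk kB]] := bmk.
  split.
    move=> j; apply: measurable_funD; first by case: bmG => mG _; exact: mG.
    rewrite /volterra_op; apply: measurable_sum => t.
    by apply: measurable_funM => //; exact: measurable_primitive.
  exists (B + A * `|Bk| * m) => j x.
  rewrite picardS; apply: le_trans (ler_normD _ _) _; apply: lerD => //.
  have k0 i y : (`|picard k i y|%:E <= `|Bk|%:E * iterated_mass mu c 0 y)%E.
    by rewrite /= mule1 lee_fin (le_trans (kB i y))// ler_norm.
  have := volterra_op_iterated_mass _ _ _ bmk (normr_ge0 Bk) k0 j x.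
  rewrite -lee_fin => /le_trans; apply.
  have A0 : 0 <= A by apply: le_trans (sA j); apply: sumr_ge0.
  rewrite !EFinM; apply: lee_wpmul2l; first by rewrite -EFinM lee_fin mulr_ge0.
  by apply: le_trans (iterated_mass_le _ _ _ _) _; rewrite /exp_coeff/= expr1 divr1.
have bm0 : bounded_measurable (picard 0).
  by split; [move=> j; exact: measurable_cst|exists 0 => j x; rewrite normr0].
elim: n => [|n [bmn IH]].
  split=> // j x; rewrite /picard/= subr0 mule1 expr0 mul1r lee_fin.
  rewrite /volterra_op big1 ?addr0 ?(le_trans (GB _ _)) ?ler_norm// => t _.
  by rewrite /Rintegral integral0 mulr0.
split; first exact: bmS.
move=> j x; rewrite 2!picardS opprD addrACA subrr add0r volterra_opB//; last exact: bmS.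
have A0 : 0 <= A by apply: le_trans (sA j); apply: sumr_ge0.
rewrite exprS -mulrA; apply: volterra_op_iterated_mass => //.
- have [[ma [Ba aB]] [mb [Bb bB]]] := (bmS _ bmn, bmn).
  split=> [i|]; first exact: measurable_funB.
  exists (Ba + Bb) => i y; apply: le_trans (ler_normB _ _) _; exact: lerD.
- by rewrite mulr_ge0// exprn_ge0.
Qed.

Lemma volterra_exists : exists U, bounded_measurable U /\
  forall j x, U j x = G j x + volterra_op U j x.
Proof.
have [mG [B GB]] := bmG.
have pS := picard_step B GB.
(* Without an index [j], [sA] says nothing about the sign of [A]. *)
have A0 (j : J) : 0 <= A by apply: le_trans (sA j); apply: sumr_ge0.
pose a n j x := picard n.+1 j x - picard n j x.
have aB n j x : `|a n j x| <= `|B| * exp_coeff (A * m) n.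
  rewrite -lee_fin; apply: le_trans ((pS n).2 j x) _.
  apply: (@le_trans _ _ ((A ^+ n * `|B|)%:E * (exp_coeff m n)%:E)%E).
    apply: lee_wpmul2l; last exact: iterated_mass_le.
    by rewrite lee_fin mulr_ge0// exprn_ge0// (A0 j).
  by rewrite -EFinM lee_fin /exp_coeff/= exprMn -!mulrA mulrCA.
have cvgB : cvgn (series (fun n => `|B| * exp_coeff (A * m) n)).
  by apply: is_cvg_seriesZ; exact: is_cvg_series_exp_coeff.
(* Iterates are partial sums of their differences, since [picard 0] is zero; the exponential series
   majorises these sums. *)
have tele j x n : picard n j x = series (fun n => a n j x) n.
  rewrite /series/= telescope_sumr//=; first by rewrite subr0.
have cvga j x : cvgn (fun n => picard n j x).
  under eq_fun do rewrite tele.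
  apply: normed_cvg; apply: series_le_cvg cvgB => n //=.
  by rewrite mulr_ge0// exp_coeff_ge0// mulr_ge0// (A0 j).
(* [E] bounds all iterates uniformly in n, j and x, and is the dominating constant below. *)
pose E := limn (series (fun n => `|B| * exp_coeff (A * m) n)).
have pE n j x : `|picard n j x| <= E.
  rewrite tele; apply: le_trans (ler_norm_sum _ _ _) _.
  apply: le_trans (ler_sum _ (fun i _ => aB i j x)) _.
  apply: (nondecreasing_cvgn_le _ cvgB); apply: nondecreasing_series => i _ _.
  by rewrite mulr_ge0// exp_coeff_ge0// mulr_ge0// (A0 j).
pose U j x := limn (fun n => picard n j x).
have pU j x : picard n j x @[n --> \oo] --> U j x by exact: cvga.
have mp n j : measurable_fun setT (picard n j) by case: (pS n) => -[mn _] _; exact: mn.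
have mU j : measurable_fun setT (U j) by apply: measurable_fun_cvg => [n|x _]; [exact: mp|exact: pU].
exists U; split.
  split=> //; exists E => j x.
  have : `|picard n j x| @[n --> \oo] --> `|U j x| by apply: cvg_norm.
  by move=> /cvg_lim <-//; apply: limr_le; [apply: is_cvg_norm; exact: cvga|exact: nearW].
(* Both sides are limits of [picard n.+1 j x]: the left one by shifting the index, the right one by
   exchanging limit and integral. *)
move=> j x; apply: (@cvg_unique _ _ ((fun n => picard n.+1 j x) @ \oo)) => //.
  by have := pU j x; rewrite -[in X in X -> _]cvg_shiftS.
apply: (@cvgD _ _ _ _ _ (fun=> G j x) (fun n => volterra_op (picard n) j x)).
  exact: cvg_cst.
apply: cvg_big => [|t _]; first exact: add_continuous.
apply: cvgM; first exact: cvg_cst.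
have mD : measurable (`[c, x[ : set R) by [].
have mpE n : measurable_fun `[c, x[ (fun y => (picard n t.1.2 y)%:E).
  by apply: measurable_funTS; apply/measurable_EFinP; exact: mp.
have mUE : measurable_fun `[c, x[ (fun y => (U t.1.2 y)%:E).
  by apply: measurable_funTS; apply/measurable_EFinP; exact: mU.
have cvgae : {ae nu t.2, forall y, `[c, x[%classic y ->
    (picard n t.1.2 y)%:E @[n --> \oo] --> (U t.1.2 y)%:E}.
  by apply: aeW => y _; apply: cvg_comp (pU t.1.2 y) _; exact: cvg_id.
have boundae : {ae nu t.2, forall y n, `[c, x[%classic y ->
    (`|(picard n t.1.2 y)%:E| <= cst E%:E y)%E}.
  by apply: aeW => y n _; exact: pE.
have [] := dominated_convergence mD mpE mUE cvgae
  (finite_measure_integrable_cst _ _ mD) boundae.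
move=> /(integrable_fin_num mD) fU _ cvgU; apply: fine_cvg.
by rewrite /Rintegral fineK.
Qed.

End volterra.

(** * Linearity of complex-valued integrals *)

Section complex_integrals.
Context {R : realType}.
Local Notation C := R[i].
Local Notation Re := (@complex.Re R).
Local Notation Im := (@complex.Im R).
Implicit Types (mu : {measure set R -> \bar R}) (D : set R) (F G : R -> C) (k : C).

Lemma complexEta (u : C) : u = Complex (Re u) (Im u).
Proof. by case: u. Qed.

Lemma Re_add (u v : C) : Re (u + v) = Re u + Re v.
Proof. by case: u; case: v. Qed.

Lemma Im_add (u v : C) : Im (u + v) = Im u + Im v.
Proof. by case: u; case: v. Qed.

Lemma Re_mul (u v : C) : Re (u * v) = Re u * Re v - Im u * Im v.
Proof. by case: u; case: v. Qed.

Lemma Im_mul (u v : C) : Im (u * v) = Re u * Im v + Im u * Re v.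
Proof. by case: u; case: v. Qed.

Lemma Re_conjugate (u : C) : Re u^* = Re u.
Proof. by case: u. Qed.

Lemma Im_conjugate (u : C) : Im u^* = - Im u.
Proof. by case: u. Qed.

Lemma sqn_eq0 (u : C) : sqn u = 0 -> u = 0.
Proof.
case: u => x y /eqP; rewrite /sqn/= paddr_eq0 ?sqr_ge0// !sqrf_eq0.
by move=> /andP[/eqP-> /eqP->].
Qed.

Definition cmeasurable D F :=
  measurable_fun D (Re \o F) /\ measurable_fun D (Im \o F).

Definition cintegrable mu D F :=
  mu.-integrable D (EFin \o (Re \o F)) /\ mu.-integrable D (EFin \o (Im \o F)).

Lemma cmeasurable_lin D k F G : cmeasurable D F -> cmeasurable D G ->
  cmeasurable D (fun x => k * F x + G x).
Proof.
move=> [rF iF] [rG iG]; split.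
- rewrite (_ : _ \o _ = (fun x => Re k * Re (F x) - Im k * Im (F x) + Re (G x))).
    apply: measurable_funD => //.
    by apply: measurable_funB; apply: measurable_funM => //; exact: measurable_cst.
  by apply/funext => x /=; rewrite Re_add Re_mul.
- rewrite (_ : _ \o _ = (fun x => Re k * Im (F x) + Im k * Re (F x) + Im (G x))).
    apply: measurable_funD => //.
    by apply: measurable_funD; apply: measurable_funM => //; exact: measurable_cst.
  by apply/funext => x /=; rewrite Im_add Im_mul.
Qed.

(** The real and the imaginary part of [k * F + G] both have this three-term shape. *)
Lemma integrable_lin3 mu D (r s : R) (f g h : R -> R) : measurable D ->
  mu.-integrable D (EFin \o f) -> mu.-integrable D (EFin \o g) ->
  mu.-integrable D (EFin \o h) ->
  mu.-integrable D (EFin \o (fun x => r * f x + s * g x + h x)) /\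
  \int[mu]_(x in D) (r * f x + s * g x + h x) =
  r * \int[mu]_(x in D) f x + s * \int[mu]_(x in D) g x + \int[mu]_(x in D) h x.
Proof.
move=> mD fi gi hi.
have rf : mu.-integrable D (EFin \o (fun x => r * f x)) by exact: (integrableZl mD r fi).
have sg : mu.-integrable D (EFin \o (fun x => s * g x)) by exact: (integrableZl mD s gi).
have rs : mu.-integrable D (EFin \o (fun x => r * f x + s * g x)) by exact: (integrableD mD rf sg).
split; first exact: (integrableD mD rs hi).
by rewrite !RintegralD// !RintegralZl.
Qed.

Lemma cintegrable_lin mu D k F G : measurable D ->
  cintegrable mu D F -> cintegrable mu D G ->
  cintegrable mu D (fun x => k * F x + G x) /\
  cint mu D (fun x => k * F x + G x) = k * cint mu D F + cint mu D G.
Proof.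
move=> mD [rF iF] [rG iG].
have [rI rE] := integrable_lin3 mu D (Re k) (- Im k) _ _ _ mD rF iF rG.
have [iI iE] := integrable_lin3 mu D (Re k) (Im k) _ _ _ mD iF rF iG.
have eqR : Re \o (fun x => k * F x + G x) =
    (fun x => Re k * (Re \o F) x + (- Im k) * (Im \o F) x + (Re \o G) x).
  by apply/funext => x /=; rewrite Re_add Re_mul mulNr.
have eqI : Im \o (fun x => k * F x + G x) =
    (fun x => Re k * (Im \o F) x + Im k * (Re \o F) x + (Im \o G) x).
  by apply/funext => x /=; rewrite Im_add Im_mul.
split; first by split; rewrite ?eqR ?eqI.
rewrite [RHS]complexEta Re_add Re_mul Im_add Im_mul /cint eqR eqI; congr Complex.
- by rewrite rE mulNr.
- by rewrite iE.
Qed.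

Lemma eq_cint mu D F G : (forall x, D x -> F x = G x) -> cint mu D F = cint mu D G.
Proof.
by move=> FG; congr Complex; apply: eq_Rintegral => x; rewrite inE => /FG /= ->.
Qed.

Lemma cint0 mu D : cint mu D (fun=> 0) = 0.
Proof. by rewrite /cint /Rintegral !integral0. Qed.

End complex_integrals.

(** * Solvability of the forward initial value problem for [tau - z] *)

Section cauchy_problem.
Context {R : realType}.
Local Notation C := R[i].
Local Notation Re := (@complex.Re R).
Local Notation Im := (@complex.Im R).
Variables (rho sp sm cp cm : {measure set R -> \bar R}) (z : C) (c d : R).
Hypotheses (rho_fin : (rho `[c, d[ < +oo)%E).
Hypotheses (sp_fin : (sp `[c, d[ < +oo)%E) (sm_fin : (sm `[c, d[ < +oo)%E).
Hypotheses (cp_fin : (cp `[c, d[ < +oo)%E) (cm_fin : (cm `[c, d[ < +oo)%E).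

Lemma coitvE (x y : R) : coitv x y = `[x, y[%classic.
Proof. by apply/seteqP; split => t /=; rewrite in_itv. Qed.

Definition cbounded_measurable (f : R -> C) :=
  cmeasurable setT f /\ exists B, forall x, `|Re (f x)| <= B /\ `|Im (f x)| <= B.

(* Solution of [(tau - z) f = h] on [[c, d]] with zero initial data at [c];
   [f1] is the quasi-derivative [df/dsigma]. *)
Definition cauchy_solution (h f f1 : R -> C) :=
  [/\ cbounded_measurable f, cbounded_measurable f1 &
    forall x, c <= x <= d ->
      f x = cint sp `[c, x[ f1 - cint sm `[c, x[ f1 /\
      f1 x = cint cp `[c, x[ f - cint cm `[c, x[ f
             - cint rho `[c, x[ (fun y => h y + z * f y)].

Let mD : measurable (`[c, d[ : set R). Proof. by []. Qed.

(** The single measure above all five coefficient measures that the Volterra theory asks for. *)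
Definition dominating_measure := measure_add (measure_add (measure_add (measure_add sp sm) cp) cm) rho.

Let dominating_measureE S :
  (dominating_measure S = sp S + sm S + cp S + cm S + rho S)%E.
Proof. by do 4![etransitivity; [exact: measure_addE|congr (_ + _)%E]]. Qed.

Let total_fin : (dominating_measure `[c, d[ < +oo)%E.
Proof. by rewrite dominating_measureE; do 4![apply: lte_add_pinfty => //]. Qed.

(** Restriction to [c, d) yields measures finite on the whole line and keeps integrals over [c, x)
    for x <= d. Index 4 is [rho], and larger indices default to it. *)
Let nu (l : nat) : {finite_measure set R -> \bar R} :=
  match l with
  | 0 => mfrestr mD sp_fin | 1 => mfrestr mD sm_fin
  | 2 => mfrestr mD cp_fin | 3 => mfrestr mD cm_fin
  | _ => mfrestr mD rho_fin end%N.

Let mu : {finite_measure set R -> \bar R} := mfrestr mD total_fin.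

Let nu_mu l S : measurable S -> (nu l S <= mu S)%E.
Proof.
move=> mS; have mSD : measurable (S `&` `[c, d[) by exact: measurableI.
rewrite [mu S](_ : _ = dominating_measure (S `&` `[c, d[))// dominating_measureE.
have leD (x y : \bar R) : (0 <= y)%E -> (x <= x + y)%E by move=> y0; rewrite leeDl.
have leD' (x y : \bar R) : (0 <= x)%E -> (y <= x + y)%E by move=> y0; rewrite leeDr.
case: l => [|[|[|[|l]]]]; rewrite /= /mfrestr /mrestr.
- by do 3![apply: (le_trans _ (leD _ _ _)) => //]; apply: leD.
- by do 3![apply: (le_trans _ (leD _ _ _)) => //]; apply: leD'.
- by do 2![apply: (le_trans _ (leD _ _ _)) => //]; apply: leD'; rewrite adde_ge0.
- by apply: (le_trans _ (leD _ _ _)) => //; apply: leD'; rewrite !adde_ge0.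
- by apply: leD'; rewrite !adde_ge0.
Qed.

Lemma Rintegral_mfrestr (m : {measure set R -> \bar R}) (mfin : (m `[c, d[ < +oo)%E) (x : R) (u : R -> R) :
  x <= d -> \int[mfrestr mD mfin]_(y in `[c, x[) u y = \int[m]_(y in `[c, x[) u y.
Proof.
move=> xd; congr fine; apply: eq_measure_integral => S mS Sx.
rewrite /= /mfrestr /mrestr setIidl// => y /Sx /=.
by rewrite !in_itv/= => /andP[-> /lt_le_trans]; apply.
Qed.

(* Indices: [(false, _)] is [f], [(true, _)] is [f1]; [(_, false)] is the real
   part, [(_, true)] the imaginary part. *)
Let sys (j : bool * bool) : seq (R * (bool * bool) * nat) :=
  match j with
  | (false, i) => [:: (1, (true, i), 0%N); (-1, (true, i), 1%N)]
  | (true, false) => [:: (1, (false, false), 2%N); (-1, (false, false), 3%N);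
      (- Re z, (false, false), 4%N); (Im z, (false, true), 4%N)]
  | (true, true) => [:: (1, (false, true), 2%N); (-1, (false, true), 3%N);
      (- Re z, (false, true), 4%N); (- Im z, (false, false), 4%N)]
  end.

Let sys_bound j : \sum_(t <- sys j) `|t.1.1| <= 2 + `|Re z| + `|Im z|.
Proof.
case: j => -[] [] /=; rewrite !big_cons big_nil/= ?normrN normr1 addr0 ?addrA//.
- by rewrite -addrA lerDl addr_ge0.
- by rewrite -addrA lerDl addr_ge0.
Qed.

Lemma cauchy_solution_exists (h : R -> C) :
  cmeasurable setT h -> cintegrable rho `[c, d[ h -> exists f f1, cauchy_solution h f f1.
Proof.
move=> [mRh mIh] [iRh iIh].
(* The source integral is frozen at [d]: [Order.min x d] makes it bounded and measurable on the
   whole line and changes nothing for x <= d. *)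
have source (u : R -> R) : measurable_fun setT u -> rho.-integrable `[c, d[ (EFin \o u) ->
    measurable_fun setT (fun x : R => \int[rho]_(y in `[c, Order.min x d[) u y) /\
    exists B, forall x, `|\int[rho]_(y in `[c, Order.min x d[) u y| <= B.
  move=> mu' iu; split.
    rewrite (_ : (fun _ => _) = (fun x => \int[nu 4%N]_(y in `[c, x[) u y) \o (fun x : R => Order.min x d)).
      by apply: measurableT_comp; [exact: measurable_primitive|exact: measurable_minr].
    by apply/funext => x /=; rewrite Rintegral_mfrestr// ge_min lexx orbT.
  exists (\int[rho]_(y in `[c, d[) `|u y|) => x.
  have sub : `[c, Order.min x d[ `<=` `[c, d[.
    by move=> y /=; rewrite !in_itv/= lt_min => /andP[-> /andP[]].
  have iux : rho.-integrable `[c, Order.min x d[ (EFin \o u) by exact: (integrableS mD).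
  apply: le_trans (le_normr_Rintegral _ iux) _ => //.
  apply: fine_le.
  - by apply: integrable_fin_num => //; exact: (integrable_norm iux).
  - by apply: integrable_fin_num => //; exact: (integrable_norm iu).
  apply: ge0_subset_integral => //.
  by apply/measurable_EFinP; apply: measurable_funTS; exact: measurableT_comp.
have [mGR [BR hBR]] := source _ mRh iRh.
have [mGI [BI hBI]] := source _ mIh iIh.
pose G (j : bool * bool) x := match j with
  | (false, _) => 0
  | (true, false) => - \int[rho]_(y in `[c, Order.min x d[) Re (h y)
  | (true, true) => - \int[rho]_(y in `[c, Order.min x d[) Im (h y) end.
have bmG : bounded_measurable G.
  split; first by case=> -[] [] /=; [exact: measurable_funN|exact: measurable_funN|exact: measurable_cst|exact: measurable_cst].
  exists (`|BR| + `|BI|) => -[[] []] x /=; rewrite ?normrN ?normr0 ?addr_ge0//.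
  - by apply: le_trans (hBI x) _; rewrite (le_trans (ler_norm _))// lerDr.
  - by apply: le_trans (hBR x) _; rewrite (le_trans (ler_norm _))// lerDl.
have [U [[mU [B UB]] UE]] := volterra_exists mu nu c sys _ nu_mu sys_bound G bmG.
pose f x := Complex (U (false, false) x) (U (false, true) x).
pose f1 x := Complex (U (true, false) x) (U (true, true) x).
exists f, f1; split.
- by split; [split; exact: mU|exists B => x; split; exact: UB].
- by split; [split; exact: mU|exists B => x; split; exact: UB].
move=> x /andP[cx xd].
have sub : `[c, x[ `<=` `[c, d[.
  by move=> y /=; rewrite !in_itv/= => /andP[-> /lt_le_trans]; apply.
have Ui j : rho.-integrable `[c, x[ (EFin \o U j).
  apply: (integrableS mD) => //; apply: measurable_bounded_integrable => //.
    exact: measurable_funTS.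
  by exists B; split; [exact: num_real|move=> M BM y _]; exact: le_trans (UB j y) (ltW BM).
have [iRx iIx] : cintegrable rho `[c, x[ h by split; exact: (integrableS mD).
have rhoE : cint rho `[c, x[ (fun y => h y + z * f y) =
    z * cint rho `[c, x[ f + cint rho `[c, x[ h.
  rewrite -(cintegrable_lin rho _ z f h _ (conj (Ui _) (Ui _)) (conj iRx iIx)).2//.
  by apply: eq_cint => y _; rewrite addrC.
rewrite rhoE [z * _]complexEta Re_mul Im_mul; split.
- rewrite /f !UE /volterra_op /= !big_cons !big_nil/= !Rintegral_mfrestr//.
  rewrite /cint; congr Complex; rewrite ?add0r ?addr0 ?mul1r ?mulN1r//.
- rewrite /f1 !UE /volterra_op /= !big_cons !big_nil/= !Rintegral_mfrestr//.
  rewrite /cint min_l//; congr Complex => /=.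
  all: by rewrite /comp /f/=; ring.
Qed.

End cauchy_problem.

(** * Superposition of solutions with zero initial data *)

Section cauchy_superposition.
Context {R : realType}.
Local Notation C := R[i].
Local Notation Re := (@complex.Re R).
Local Notation Im := (@complex.Im R).

Lemma cbounded_measurable_lin (k : C) (f g : R -> C) :
  cbounded_measurable f -> cbounded_measurable g ->
  cbounded_measurable (fun x => k * f x + g x).
Proof.
move=> [mf [B fB]] [mg [B' gB]]; split; first exact: cmeasurable_lin.
exists ((`|Re k| + `|Im k|) * B + B') => x.
have [rf jf] := fB x; have [rg jg] := gB x.
rewrite Re_add Im_add Re_mul Im_mul mulrDl; split.
- by apply: le_trans (ler_normD _ _) (lerD _ rg);
    apply: le_trans (ler_normB _ _) (lerD _ _); rewrite normrM ler_wpM2l.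
- by apply: le_trans (ler_normD _ _) (lerD _ jg);
    apply: le_trans (ler_normD _ _) (lerD _ _); rewrite normrM ler_wpM2l.
Qed.

Lemma cbounded_cintegrable (m : {measure set R -> \bar R}) (D : set R) (f : R -> C) :
  measurable D -> (m D < +oo)%E -> cbounded_measurable f -> cintegrable m D f.
Proof.
move=> mD mfin [[mR mI] [B fB]]; split; apply: measurable_bounded_integrable => //.
- exact: measurable_funTS.
- exists B; split; [exact: num_real|move=> M BM y _].
  by apply: le_trans (ltW BM); case: (fB y).
- exact: measurable_funTS.
- exists B; split; [exact: num_real|move=> M BM y _].
  by apply: le_trans (ltW BM); case: (fB y).
Qed.

Lemma cintegrableS (m : {measure set R -> \bar R}) (D E : set R) (f : R -> C) :
  measurable E -> measurable D -> D `<=` E -> cintegrable m E f -> cintegrable m D f.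
Proof. by move=> mE mD DE [rf jf]; split; exact: (integrableS mE). Qed.

Variables (rho sp sm cp cm : {measure set R -> \bar R}) (z : C) (c d : R).
Hypotheses (rho_fin : (rho `[c, d[ < +oo)%E).
Hypotheses (sp_fin : (sp `[c, d[ < +oo)%E) (sm_fin : (sm `[c, d[ < +oo)%E).
Hypotheses (cp_fin : (cp `[c, d[ < +oo)%E) (cm_fin : (cm `[c, d[ < +oo)%E).
Local Notation solution := (cauchy_solution rho sp sm cp cm z c d).

Lemma sub_co_itv (x : R) : x <= d -> `[c, x[ `<=` `[c, d[.
Proof.
by move=> xd y /=; rewrite !in_itv/= => /andP[-> /lt_le_trans]; apply.
Qed.

Lemma cauchy_solution0 : solution (fun=> 0) (fun=> 0) (fun=> 0).
Proof.
have b0 : cbounded_measurable (fun _ : R => 0 : C).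
  by split; [split; exact: measurable_cst|exists 0 => x; rewrite normr0].
split=> // x _; rewrite !cint0 (eq_cint _ _ _ (fun=> 0)) ?cint0 ?subr0//.
by move=> y _; rewrite mulr0 addr0.
Qed.

Lemma cauchy_solution_lin (k : C) (h h' f f' f1 f1' : R -> C) :
  cintegrable rho `[c, d[ h -> cintegrable rho `[c, d[ h' ->
  solution h f f1 -> solution h' f' f1' ->
  solution (fun x => k * h x + h' x) (fun x => k * f x + f' x) (fun x => k * f1 x + f1' x).
Proof.
move=> ih ih' [bf bf1 fE] [bf' bf1' fE']; split; [exact: cbounded_measurable_lin..|].
move=> x cxd; have [fx f1x] := fE x cxd; have [fx' f1x'] := fE' x cxd.
have xd : x <= d by case/andP: cxd.
have sub := sub_co_itv x xd.
have mD : measurable (`[c, d[ : set R) by [].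
have mX : measurable (`[c, x[ : set R) by [].
have fin (m : {measure set R -> \bar R}) : (m `[c, d[ < +oo)%E -> (m `[c, x[ < +oo)%E.
  by apply: le_lt_trans; apply: le_measure; rewrite ?inE.
have lin (m : {measure set R -> \bar R}) (u v : R -> C) : (m `[c, d[ < +oo)%E ->
    cbounded_measurable u -> cbounded_measurable v ->
    cint m `[c, x[ (fun y => k * u y + v y) = k * cint m `[c, x[ u + cint m `[c, x[ v.
  move=> mfin bu bv; apply: (cintegrable_lin m _ k u v mX _ _).2;
  by apply: cbounded_cintegrable => //; exact: fin.
have ci u : cbounded_measurable u -> cintegrable rho `[c, x[ (fun y => z * u y + 0).
  by move=> bu; apply: (cintegrable_lin rho _ z u (fun=> 0) mX _ _).1;
    apply: cbounded_cintegrable => //; try exact: fin; case: cauchy_solution0.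
have iH u v : cintegrable rho `[c, d[ v -> cbounded_measurable u -> cintegrable rho `[c, x[ (fun y => v y + z * u y).
  move=> iv bu; have ivx := cintegrableS rho _ _ v mD mX sub iv.
  (* The factor [1] and the summand [0] match the pattern [k * F + G] of [cintegrable_lin]. *)
  rewrite (_ : (fun _ => _) = (fun y => 1 * v y + (z * u y + 0))).
    exact: (cintegrable_lin rho _ 1 v _ mX ivx (ci u bu)).1.
  by apply/funext => y; rewrite mul1r addr0.
split; first by rewrite !lin// fx fx' mulrBr addrACA opprD.
rewrite !lin// f1x f1x' !mulrBr.
rewrite [X in _ = _ - X](eq_cint rho _ _ (fun y => k * (h y + z * f y) + (h' y + z * f' y))); last first.
  by move=> y _ /=; rewrite [z * (_ + _)]mulrDr [z * (k * _)]mulrCA addrACA -mulrDr.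
rewrite (cintegrable_lin rho _ k _ _ mX (iH f h ih bf) (iH f' h' ih' bf')).2.
by rewrite !opprD addrACA (addrACA (k * _) (- _)).
Qed.

Lemma cauchy_solution_sum (I : Type) (r : seq I) (k : I -> C) (h f f1 : I -> R -> C) :
  (forall i, cintegrable rho `[c, d[ (h i)) -> (forall i, solution (h i) (f i) (f1 i)) ->
  cintegrable rho `[c, d[ (fun x => \sum_(i <- r) k i * h i x) /\
  solution (fun x => \sum_(i <- r) k i * h i x)
    (fun x => \sum_(i <- r) k i * f i x) (fun x => \sum_(i <- r) k i * f1 i x).
Proof.
move=> ih sol; elim: r => [|i r [IHi IHs]].
  have -> : (fun x => \sum_(i <- [::]) k i * h i x) = fun=> 0.
    by apply/funext => x; rewrite big_nil.
  have -> : (fun x => \sum_(i <- [::]) k i * f i x) = fun=> 0.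
    by apply/funext => x; rewrite big_nil.
  have -> : (fun x => \sum_(i <- [::]) k i * f1 i x) = fun=> 0.
    by apply/funext => x; rewrite big_nil.
  split; last exact: cauchy_solution0.
  by apply: cbounded_cintegrable => //; case: cauchy_solution0.
have cons (u : I -> R -> C) : (fun x => \sum_(j <- i :: r) k j * u j x) =
    (fun x => k i * u i x + (\sum_(j <- r) k j * u j x)).
  by apply/funext => x; rewrite big_cons.
rewrite !cons; split; first exact: (cintegrable_lin rho _ (k i) _ _ _ (ih i) IHi).1.
exact: cauchy_solution_lin.
Qed.

End cauchy_superposition.

(** * Square-integrable functions on (a, b) *)

Section square_integrable.
Context {R : realType}.
Local Notation C := R[i].
Local Notation Re := (@complex.Re R).
Local Notation Im := (@complex.Im R).
Variables (a b : \bar R) (rho : {measure set R -> \bar R}).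
Implicit Types (f g : R -> C).

Lemma measurable_oitv : measurable (oitv a b).
Proof.
rewrite (_ : oitv a b = setT `&` EFin @^-1` `]a, b[%classic).
  by apply: EFin_measurable => //; exact: emeasurable_itv.
by apply/seteqP; split => x /=; rewrite in_itv/=; [move=> [-> ->]|move=> [_ /andP]].
Qed.

Lemma sqnE (u : C) : sqn u = Re u ^+ 2 + Im u ^+ 2. Proof. by []. Qed.

Lemma sqn_ge0 (u : C) : 0 <= sqn u.
Proof. by rewrite addr_ge0 ?sqr_ge0. Qed.

Lemma measurable_sqn (D : set R) f : cmeasurable D f -> measurable_fun D (sqn \o f).
Proof.
by move=> [mR mI]; apply: measurable_funD; exact: (measurable_funX 2).
Qed.

Lemma L2_lin (k : C) f g : L2 a b rho f -> L2 a b rho g ->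
  L2 a b rho (fun x => k * f x + g x).
Proof.
move=> [mRf [mIf iF]] [mRg [mIg iG]].
have [mR mI] := cmeasurable_lin _ k f g (conj mRf mIf) (conj mRg mIg).
split=> //; split=> //.
have mO := measurable_oitv.
apply: (@le_integrable _ _ _ _ _ mO _ (fun x => (2 * sqn k)%:E * (EFin \o (sqn \o f)) x +
    2%:E * (EFin \o (sqn \o g)) x)%E).
- by apply/measurable_EFinP; exact: measurable_sqn.
- move=> x _; rewrite /= lee_fin ger0_norm ?sqn_ge0//.
  rewrite ger0_norm; last by rewrite addr_ge0// !mulr_ge0// sqn_ge0.
  rewrite !sqnE Re_add Im_add Re_mul Im_mul.
  move: (Re k) (Im k) (Re (f x)) (Im (f x)) (Re (g x)) (Im (g x)) => p q r s t u.
  (* Parallelogram identity: the difference of the two sides is [sqn (k * f x - g x)]. *)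
  rewrite -subr_ge0 (_ : _ - _ = (p * r - q * s - t) ^+ 2 + (p * s + q * r - u) ^+ 2); last by ring.
  by rewrite addr_ge0 ?sqr_ge0.
- by apply: integrableD => //; exact: integrableZl.
Qed.

Lemma L2_cintegrable_conjM f g : L2 a b rho f -> L2 a b rho g ->
  cintegrable rho (oitv a b) (fun x => f x * (g x)^*).
Proof.
move=> [mRf [mIf iF]] [mRg [mIg iG]].
have mO := measurable_oitv.
have bound (u : R -> R) : measurable_fun (oitv a b) u ->
    (forall x, `|u x| <= sqn (f x) + sqn (g x)) -> rho.-integrable (oitv a b) (EFin \o u).
  move=> mu uB; apply: (@le_integrable _ _ _ _ _ mO _
      (fun x => (EFin \o (sqn \o f)) x + (EFin \o (sqn \o g)) x)%E).
  - exact/measurable_EFinP.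
  - move=> x _; rewrite /= lee_fin (le_trans (uB x))//.
    by rewrite ger0_norm// addr_ge0// sqn_ge0.
  - exact: integrableD.
split; apply: bound.
- rewrite (_ : _ \o _ = (fun x => Re (f x) * Re (g x) + Im (f x) * Im (g x))).
    by apply: measurable_funD; exact: measurable_funM.
  by apply/funext => x /=; rewrite Re_mul Re_conjugate Im_conjugate mulrN opprK.
- move=> x /=; rewrite Re_mul Re_conjugate Im_conjugate !sqnE.
  move: (Re (f x)) (Im (f x)) (Re (g x)) (Im (g x)) => r s t u.
  (* A product of two components, with either sign, is at most half the sum of their squares. *)
  have h1 := sqr_ge0 (r + t); have h2 := sqr_ge0 (r - t).
  have h3 := sqr_ge0 (r + u); have h4 := sqr_ge0 (r - u).
  have h5 := sqr_ge0 (s + t); have h6 := sqr_ge0 (s - t).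
  have h7 := sqr_ge0 (s + u); have h8 := sqr_ge0 (s - u).
  by rewrite ler_norml; apply/andP; split; nra.
- rewrite (_ : _ \o _ = (fun x => Im (f x) * Re (g x) - Re (f x) * Im (g x))).
    by apply: measurable_funB; exact: measurable_funM.
  by apply/funext => x /=; rewrite Im_mul Re_conjugate Im_conjugate mulrN addrC.
- move=> x /=; rewrite Im_mul Re_conjugate Im_conjugate !sqnE.
  move: (Re (f x)) (Im (f x)) (Re (g x)) (Im (g x)) => r s t u.
  have h1 := sqr_ge0 (r + t); have h2 := sqr_ge0 (r - t).
  have h3 := sqr_ge0 (r + u); have h4 := sqr_ge0 (r - u).
  have h5 := sqr_ge0 (s + t); have h6 := sqr_ge0 (s - t).
  have h7 := sqr_ge0 (s + u); have h8 := sqr_ge0 (s - u).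
  by rewrite ler_norml; apply/andP; split; nra.
Qed.

Lemma co_itv_sub_oitv (c d : R) : oitv a b c -> oitv a b d -> `[c, d[ `<=` oitv a b.
Proof.
move=> [ac _] [_ db] x /=; rewrite in_itv/= => /andP[cx xd]; split.
  by rewrite (lt_le_trans ac)// lee_fin.
by rewrite (lt_trans _ db)// lte_fin.
Qed.

Lemma cc_itv_sub_oitv (c d : R) : oitv a b c -> oitv a b d -> citv c d `<=` oitv a b.
Proof.
move=> [ac _] [_ db] x /= /andP[cx xd]; split.
  by rewrite (lt_le_trans ac)// lee_fin.
by rewrite (le_lt_trans _ db)// lee_fin.
Qed.

Lemma measurable_citv (c d : R) : measurable (citv c d).
Proof.
by rewrite (_ : citv c d = `[c, d]%classic).
Qed.

(** On a set of finite mass L^2 is contained in L^1, because |Re f| and |Im f| are at most 1 +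
    |f|^2. *)
Lemma L2_cintegrable (D : set R) f : measurable D -> D `<=` oitv a b ->
  (rho D < +oo)%E -> L2 a b rho f -> cintegrable rho D f.
Proof.
move=> mD sub rD [mR [mI iF]]; have mO := measurable_oitv.
have bound (u : R -> R) : measurable_fun D u ->
    (forall x, `|u x| <= 1 + sqn (f x)) -> rho.-integrable D (EFin \o u).
  move=> mu uB; apply: (@le_integrable _ _ _ _ _ mD _
      (fun x => (EFin \o cst 1%R) x + (EFin \o (sqn \o f)) x)%E).
  - exact/measurable_EFinP.
  - move=> x _; rewrite /= lee_fin (le_trans (uB x))//.
    by rewrite ler_norm.
  - apply: integrableD => //; last exact: (integrableS mO).
    apply: measurable_bounded_integrable => //.
    by exists 1; split=> // M M1 x _; rewrite /= normr1 ltW.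
split; apply: bound => [|x]; try exact: (measurable_funS mO).
- by rewrite sqnE ler_norml; apply/andP; split => /=; nra.
- by rewrite sqnE ler_norml; apply/andP; split => /=; nra.
Qed.

End square_integrable.

(** * Extension of solutions by zero and membership in [T0] *)

Section compactly_supported_solutions.
Import numFieldNormedType.Exports.
Context {R : realType}.
Local Notation C := R[i].
Local Notation Re := (@complex.Re R).
Local Notation Im := (@complex.Im R).
Variables (a b : \bar R) (rho sp sm cp cm : {measure set R -> \bar R}) (z : C).
Hypotheses (rho_lf : locfin a b rho).
Hypotheses (sp_lf : locfin a b sp) (sm_lf : locfin a b sm).
Implicit Types (m : {measure set R -> \bar R}) (u : R -> C).

Lemma locfin_co m (c d : R) : locfin a b m -> oitv a b c -> oitv a b d ->
  (m `[c, d[ < +oo)%E.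
Proof.
move=> [_ fin] oc od; apply: le_lt_trans (fin c d oc od).
apply: le_measure; rewrite ?inE//; first exact: measurable_citv.
by move=> x /=; rewrite /citv/= in_itv/= => /andP[-> /ltW].
Qed.

(** Half-open like the domain of integration in [intc]: an atom at [c] counts and one at [d] does
    not. *)
Definition cutoff (c d : R) u : R -> C := fun x => if c <= x < d then u x else 0.

Lemma cutoff_out (c d : R) u x : ~~ (c <= x < d) -> cutoff c d u x = 0.
Proof. by rewrite /cutoff => /negbTE ->. Qed.

Lemma cbounded_measurable_cutoff (c d : R) u :
  cbounded_measurable u -> cbounded_measurable (cutoff c d u).
Proof.
move=> [[mR mI] [B uB]]; split; last first.
  exists B => x; rewrite /cutoff; case: ifPn => // _; rewrite normr0.
  by have [/(le_trans (normr_ge0 _))] := uB x.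
have mcd : measurable_fun setT (fun x : R => (c <= x) && (x < d)).
  by apply: measurable_and; [exact: measurable_fun_ler|exact: measurable_fun_ltr].
split.
- rewrite (_ : _ \o _ = (fun x => if (c <= x) && (x < d) then Re (u x) else 0)).
    by apply: measurable_fun_ifT.
  by apply/funext => x /=; rewrite /cutoff; case: ifPn.
- rewrite (_ : _ \o _ = (fun x => if (c <= x) && (x < d) then Im (u x) else 0)).
    by apply: measurable_fun_ifT.
  by apply/funext => x /=; rewrite /cutoff; case: ifPn.
Qed.

Lemma cint_support m (A B : set R) u : B `<=` A ->
  (forall x, A x -> ~ B x -> u x = 0) -> cint m A u = cint m B u.
Proof.
move=> BA u0.
have restrE (p : C -> R) : p 0 = 0 -> (p \o u) \_ A = (p \o u) \_ B.
  move=> p0; apply/funext => x; rewrite /patch.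
  have [xB|xB] := boolP (x \in B).
    by rewrite mem_set//; apply: BA; exact: set_mem.
  case: ifPn => // /set_mem Ax; rewrite /= u0// => Bx.
  by rewrite mem_set in xB.
by congr Complex; rewrite Rintegral_mkcond [RHS]Rintegral_mkcond restrE.
Qed.

(** Left of [c] the function vanishes, so backward integrals are zero; beyond [d] forward integrals
    stay constant. *)
Lemma intc_supported m (c d : R) u : c <= d ->
  (forall x, ~~ (c <= x < d) -> u x = 0) ->
  forall x, intc m c x u = if c < x then cint m `[c, Order.min x d[ u else 0.
Proof.
move=> cd u0 x; rewrite /intc; case: ltP => [cx|xc].
  rewrite coitvE; apply: cint_support => y /=; rewrite !in_itv/= lt_min.
    by move=> /andP[-> /andP[->]].
  move=> /andP[cy yx] /negP; rewrite cy yx/= => yd.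
  by apply: u0; rewrite cy.
case: ifPn => // xc'; rewrite (eq_cint _ _ _ (fun=> 0)) ?cint0 ?oppr0//.
by move=> y /= /andP[xy yc]; apply: u0; rewrite leNgt yc.
Qed.

Lemma L2_cbounded (c d : R) u : oitv a b c -> oitv a b d ->
  cbounded_measurable u -> L2 a b rho (cutoff c d u).
Proof.
move=> oc od bu.
have [[mR mI] _] := cbounded_measurable_cutoff c d u bu.
have mO := measurable_oitv a b.
split; first exact: measurable_funTS.
split; first exact: measurable_funTS.
apply: (integrableS measurableT) => //.
rewrite (_ : _ \o _ = (EFin \o (sqn \o u)) \_ `[c, d[); last first.
  apply/funext => x; rewrite /patch /= mem_setE in_itv/= /cutoff.
  by case: ifPn => //= _; rewrite /sqn/= expr0n/= addr0.
apply/(integrable_mkcond _ _).1 => //.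
have [mu [B uB]] := bu.
apply: measurable_bounded_integrable => //.
- exact: locfin_co.
- by apply: measurable_funTS; exact: measurable_sqn.
exists (B ^+ 2 + B ^+ 2); split; first exact: num_real.
move=> M BM x _; apply: le_trans (ltW BM); have [Rx Ix] := uB x.
rewrite /= ger0_norm ?sqn_ge0// sqnE.
rewrite -(real_normK (num_real (Re (u x)))) -(real_normK (num_real (Im (u x)))).
by apply: lerD; apply: lerXn2r; rewrite ?nnegrE// (le_trans _ Rx).
Qed.

(** Data at [c] vanish because [c, c) is empty, data at [d] vanish by assumption; so [f] and its
    quasi-derivative continue by zero on both sides and the integrated equations persist on (a,
    b). *)
Lemma T0_of_cauchy_solution (c d : R) (h f f1 : R -> C) :
  c < d -> oitv a b c -> oitv a b d -> L2 a b rho h ->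
  (forall x, ~~ (c <= x < d) -> h x = 0) ->
  cauchy_solution rho sp sm cp cm z c d h f f1 -> f d = 0 -> f1 d = 0 ->
  T0 a b rho sp sm cp cm (cutoff c d f) (fun x => h x + z * cutoff c d f x).
Proof.
move=> cd oc od L2h h0 [bf bf1 fE] fd f1d.
set g := fun x => h x + z * cutoff c d f x.
have L2f : L2 a b rho (cutoff c d f) by exact: L2_cbounded.
have L2g : L2 a b rho g.
  rewrite (_ : g = (fun x => z * cutoff c d f x + h x)); first exact: L2_lin.
  by apply/funext => x; rewrite /g addrC.
have aerefl (u : R -> C) : aeq a b rho u u by apply: aeW.
split=> //; split=> //; exists (cutoff c d f), g; split; last first.
  split=> //; exists c, d; split=> //; split=> // x _ nx.
  apply: cutoff_out; apply/negP => /andP[cx xd]; apply: nx.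
  by rewrite /citv/= cx ltW.
have bcf := cbounded_measurable_cutoff c d f bf.
have bcf1 := cbounded_measurable_cutoff c d f1 bf1.
have fin_cc m x y : locfin a b m -> oitv a b x -> oitv a b y -> (m (citv x y) < +oo)%E.
  by move=> [_]; apply.
have locint_bounded m u : locfin a b m -> cbounded_measurable u -> locint a b m u.
  move=> lf bu x y ox oy; apply: (cbounded_cintegrable m (citv x y) u) => //.
    exact: measurable_citv.
  exact: fin_cc.
have cutc u : u c = 0 -> cutoff c d u c = 0 by rewrite /cutoff => ->; rewrite if_same.
(* From [d] on, the left side is 0 and the right side is [u d]: here the end conditions enter. *)
have minE u x : c <= x -> u d = 0 -> cutoff c d u x = u (Order.min x d).
  by move=> cx ud; rewrite /cutoff cx/=; case: ltP.
have supp u x : ~~ (c <= x < d) -> cutoff c d u x = 0 by exact: cutoff_out.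
have cintE m u x : cint m `[c, Order.min x d[ (cutoff c d u) = cint m `[c, Order.min x d[ u.
  by apply: eq_cint => y /=; rewrite in_itv/= lt_min /cutoff => /andP[-> /andP[_ ->]].
have [fc f1c] : f c = 0 /\ f1 c = 0.
  have := fE c; rewrite lexx ltW// => /(_ isT)[-> ->].
  rewrite set_itvco0 //.
  by rewrite /cint !Rintegral_set0 !subrr.
have cc_lt u x : x < c -> cutoff c d u x = 0.
  by move=> xc; apply: supp; rewrite leNgt xc.
have range x : c < x -> c <= Order.min x d <= d.
  by move=> cx; rewrite le_min (ltW cx) (ltW cd) ge_min lexx orbT.
(* This [F] makes the defining relation of [Dtau] hold at every point; what remains is that
   [cutoff c d f] and [F] are primitives of the stated densities. *)
exists (cutoff c d f1), (fun x => - cutoff c d f1 x + sintc cp cm c x (cutoff c d f)).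
split.
  split; first exact: locint_bounded.
  split; first exact: locint_bounded.
  exists c; split=> // x _.
  rewrite cutc// add0r /sintc !(intc_supported _ c d)//; try exact: ltW; try exact: supp.
  case: ltgtP => [cx|xc|<-]; [|by rewrite cc_lt// subrr|by rewrite cutc// subrr].
  rewrite !cintE minE//; last exact: ltW.
  exact: (fE _ (range x cx)).1.
split; last first.
  by exists c; split=> //; split; apply: aeW => x _.
split.
  move=> x y ox oy.
  have ih : cintegrable rho (citv x y) h.
    apply: (L2_cintegrable a b) => //; [exact: measurable_citv|exact: cc_itv_sub_oitv|exact: fin_cc].
  have ic := locint_bounded rho _ rho_lf bcf x y ox oy.
  have := (cintegrable_lin rho _ z _ _ (measurable_citv x y) ic ih).1.
  rewrite (_ : (fun _ => _) = g)//; by apply/funext => t; rewrite /g addrC.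
exists c; split=> // x _.
rewrite cutc// /sintc !(intc_supported _ c d)//; try exact: ltW; try exact: supp; last first.
  by move=> y yc; rewrite /g h0// supp// mulr0 addr0.
rewrite ltxx subrr oppr0 !add0r.
case: ltgtP => [cx|xc|<-]; [|by rewrite cc_lt// !oppr0 !addr0|by rewrite cutc// !oppr0 !addr0].
rewrite !cintE minE//; last exact: ltW.
(* The equation for [f1] at [Order.min x d] cancels the chi-integrals and leaves the [rho]-integral
   of [h + z f]. *)
rewrite (fE _ (range x cx)).2 opprB subrK.
apply: eq_cint => y /=; rewrite in_itv/= lt_min => /andP[cy /andP[_ yd]].
by rewrite /g /cutoff cy yd.
Qed.

End compactly_supported_solutions.

(** * A common nonzero vector in a directed family of subspaces *)

Section directed_subspaces.
Variables (F : fieldType) (n : nat) (I : Type) (P : I -> 'rV[F]_n -> Prop).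
Hypothesis P0 : forall i, P i 0.
Hypothesis PD : forall i u v, P i u -> P i v -> P i (u + v).
Hypothesis Pne : forall i, exists2 v, P i v & v != 0.
Hypothesis PI : forall i j, exists l, forall v, P l v -> P i v /\ P j v.
Hypothesis PZ : forall i (k : F) u, P i u -> P i (k *: u).

(* Choose a member whose largest rank of an included matrix is smallest: a
   matrix attaining that rank is then included in every member. *)
Lemma directed_subspaces_common (i0 : I) : exists2 v, v != 0 & forall i, P i v.
Proof.
pose inP i (A : 'M[F]_n) := forall v : 'rV_n, (v <= A)%MS -> P i v.
pose Q r := exists i, forall A, inP i A -> (\rank A <= r)%N.
have Qn : exists r, `[< Q r >].
  by exists n; apply/asboolP; exists i0 => A _; exact: rank_leq_row.
case: (ex_minnP Qn) => r /asboolP[i iP] rmin.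
have in0 l : inP l 0 by move=> v; rewrite submx0 => /eqP ->.
(* If every matrix included in [P l] had rank below [r], then [r.-1] would satisfy [Q], against
   minimality. *)
have big l : exists2 A, inP l A & (r <= \rank A)%N.
  apply: contrapT => nA.
  case: (posnP r) => [r0|r_gt0].
    by apply: nA; exists 0; rewrite ?r0.
  have : (r <= r.-1)%N; last by rewrite leqNgt prednK// leqnn.
  apply: rmin; apply/asboolP; exists l => A lA.
  rewrite -ltnS prednK// ltnNge; apply/negP => rA; apply: nA.
  by exists A.
have [A iA rA] := big i.
(* A nonzero vector of [P i] spans an included matrix of rank 1, so [r] is positive. *)
have Ane : A != 0.
  have [v iv v0] := Pne i.
  have iv' : inP i <<v>>%MS.
    by move=> w; rewrite genmxE => /sub_rVP[k ->]; exact: PZ.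
  have := iP _ iv'; rewrite mxrank_gen rank_rV v0 => r_gt0.
  by rewrite -mxrank_eq0 -lt0n (leq_trans r_gt0).
have /rowV0Pn[v vA v0] := Ane.
(* [B] has rank at least [r], while [B + A] is still included in [P i] and has rank at most [r]. So
   the row space of [A] lies in that of [B], which is included in [P l] and hence in [P j]. *)
exists v => // j; have [l lij] := PI i j.
have [B lB rB] := big l.
have AB : inP i (B + A)%MS.
  move=> w /sub_addsmxP[[x y] /= ->]; apply: PD; last by apply: iA; exact: submxMl.
  by have [] := lij _ (lB _ (submxMl x B)).
have sBA := mxrank_leqif_sup (addsmxSl B A).
have BAB : (B + A <= B)%MS by rewrite -sBA.2 eqn_leq sBA.1/= (leq_trans (iP _ AB)).
have vB : (v <= B)%MS by rewrite (submx_trans vA)// (submx_trans _ BAB)// addsmxSr.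
by have [] := lij v (lB v vB).
Qed.

End directed_subspaces.

(** * Linearity of defect spaces and local dependence of three elements *)

Section defect_spaces.
Import numFieldNormedType.Exports.
Context {R : realType}.
Local Notation C := R[i].
Local Notation Re := (@complex.Re R).
Local Notation Im := (@complex.Im R).
Variables (a b : \bar R) (rho sp sm cp cm : {measure set R -> \bar R}).
Implicit Types (u v : R -> C) (z k : C).
Local Notation defect := (defect a b rho sp sm cp cm).

Lemma Tmin_of_T0 u v :
  T0 a b rho sp sm cp cm u v -> Tmin a b rho sp sm cp cm u v.
Proof.
move=> uvT0; have [L2u [L2v _]] := uvT0; split=> //; split=> // e e0.
exists u, v; split=> //.
have int0 w : (\int[rho]_(x in oitv a b) (sqn (w x - w x))%:E = 0)%E.
  by apply: integral0_eq => x _; rewrite subrr /sqn/= expr0n/= addr0.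
by rewrite !int0 adde0.
Qed.

Lemma L2_cst0 : L2 a b rho (fun=> 0).
Proof.
split; first exact: measurable_cst.
split; first exact: measurable_cst.
rewrite (_ : _ \o _ = cst 0%E); first exact: integrable0.
by apply/funext => x; rewrite /sqn/= expr0n/= addr0.
Qed.

Lemma defect_cst0 z : defect z (fun=> 0).
Proof.
split; first exact: L2_cst0.
move=> f g _; rewrite (eq_cint _ _ _ (fun=> 0)) ?cint0// => x _.
by rewrite mul0r.
Qed.

Lemma defect_lin z k u v : defect z u -> defect z v ->
  defect z (fun x => k * u x + v x).
Proof.
move=> [L2u uP] [L2v vP]; split; first exact: L2_lin.
move=> f g fg; have [L2f [L2g _]] := fg.
have L2w : L2 a b rho (fun x => g x - z * f x).
  rewrite (_ : (fun _ => _) = (fun x => - z * f x + g x)); first exact: L2_lin.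
  by apply/funext => x; rewrite mulNr addrC.
rewrite (eq_cint _ _ _ (fun x => k * (u x * (g x - z * f x)^*) + v x * (g x - z * f x)^*)).
  rewrite (cintegrable_lin rho _ k (fun x => u x * (g x - z * f x)^*)
    (fun x => v x * (g x - z * f x)^*) (measurable_oitv a b)
    (L2_cintegrable_conjM a b rho u _ L2u L2w) (L2_cintegrable_conjM a b rho v _ L2v L2w)).2.
  by rewrite uP// vP// mulr0 addr0.
by move=> x _ /=; rewrite mulrDl mulrA.
Qed.

Lemma defect_sum z (I : Type) (r : seq I) (k : I -> C) (e : I -> R -> C) :
  (forall i, defect z (e i)) -> defect z (fun x => \sum_(i <- r) k i * e i x).
Proof.
move=> ez; elim: r => [|i r IH].
  rewrite (_ : (fun _ => _) = fun=> 0); first exact: defect_cst0.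
  by apply/funext => x; rewrite big_nil.
rewrite (_ : (fun _ => _) = (fun x => k i * e i x + (\sum_(j <- r) k j * e j x))).
  exact: defect_lin.
by apply/funext => x; rewrite big_cons.
Qed.

Hypotheses (rho_lf : locfin a b rho).
Hypotheses (sp_lf : locfin a b sp) (sm_lf : locfin a b sm).
Hypotheses (cp_lf : locfin a b cp) (cm_lf : locfin a b cm).

Lemma cutoff_lin (c d : R) (I : Type) (r : seq I) (k : I -> C) (e : I -> R -> C) x :
  \sum_(i <- r) k i * cutoff c d (e i) x = cutoff c d (fun x => \sum_(i <- r) k i * e i x) x.
Proof.
by rewrite /cutoff; case: ifPn => // _; rewrite big1// => i _; rewrite mulr0.
Qed.

Lemma L2_cutoff (c d : R) u : oitv a b c -> oitv a b d -> L2 a b rho u ->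
  cmeasurable setT (cutoff c d u) /\ L2 a b rho (cutoff c d u).
Proof.
move=> oc od [mR [mI iu]].
have mO := measurable_oitv a b; have sub := co_itv_sub_oitv a b c d oc od.
have mcut (p : C -> R) : p 0 = 0 -> measurable_fun (oitv a b) (p \o u) ->
    measurable_fun setT (p \o cutoff c d u).
  move=> p0 mp; rewrite (_ : _ \o _ = (p \o u) \_ `[c, d[).
    by apply/(measurable_restrictT _ _).1 => //; exact: (measurable_funS mO).
  apply/funext => x; rewrite /patch /= mem_setE in_itv/= /cutoff.
  by case: ifPn.
have mRT : measurable_fun setT (Re \o cutoff c d u) by exact: mcut.
have mIT : measurable_fun setT (Im \o cutoff c d u) by exact: mcut.
split=> //; split; first exact: measurable_funTS.
split; first exact: measurable_funTS.
apply: (@le_integrable _ _ _ _ _ mO _ (EFin \o (sqn \o u))) => //.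
  by apply/measurable_EFinP; apply: measurable_funTS; exact: measurable_sqn.
move=> x _; rewrite /= lee_fin !ger0_norm ?sqn_ge0// /cutoff.
by case: ifPn => // _; rewrite [leLHS](_ : _ = 0) ?sqn_ge0// /sqn/= expr0n/= addr0.
Qed.

(* The two conditions [f d = f1 d = 0] are solvable in [C^3]: some nonzero
   combination of the truncated [e i] lies in [ran(T0 - z)], and being
   orthogonal to that range it is orthogonal to itself. *)
Lemma defect_locally_dependent z (e : 'I_3 -> R -> C) (c d : R) :
  (forall i, defect z (e i)) -> oitv a b c -> oitv a b d -> c < d ->
  exists2 k : 'rV[C]_3, k != 0 &
    {ae rho, forall x, c <= x < d -> \sum_i k 0 i * e i x = 0}.
Proof.
move=> ez oc od cd.
have mO := measurable_oitv a b; have sub := co_itv_sub_oitv a b c d oc od.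
pose h i := cutoff c d (e i).
have L2e i : L2 a b rho (e i) by case: (ez i).
have L2h i : L2 a b rho (h i) := (L2_cutoff c d (e i) oc od (L2e i)).2.
have mh i : cmeasurable setT (h i) := (L2_cutoff c d (e i) oc od (L2e i)).1.
have fin m : locfin a b m -> (m `[c, d[ < +oo)%E by move=> lf; exact: (locfin_co a b).
have ih i : cintegrable rho `[c, d[ (h i).
  by apply: (L2_cintegrable a b) => //; exact: fin.
have /choice[ff1 ff1P] : forall i, exists p : (R -> C) * (R -> C),
    cauchy_solution rho sp sm cp cm z c d (h i) p.1 p.2.
  move=> i; have [f [f1 sol]] := cauchy_solution_exists rho sp sm cp cm z c d
    (fin _ rho_lf) (fin _ sp_lf) (fin _ sm_lf) (fin _ cp_lf) (fin _ cm_lf) (h i) (mh i) (ih i).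
  by exists (f, f1).
pose A : 'M[C]_(3, 2) := \matrix_(i, j) (if j == 0 then (ff1 i).1 d else (ff1 i).2 d).
(* Three rows against two columns of end values: the rank is at most 2, so the left kernel is
   nonzero. *)
have : kermx A != 0.
  by rewrite -mxrank_eq0 mxrank_ker subn_eq0 -ltnNge (leq_ltn_trans (rank_leq_col A)).
move=> /rowV0Pn[k /sub_kermxP kA k0]; exists k => //.
have colA j : \sum_i k 0 i * A i j = 0.
  by have := congr1 (fun M : 'rV_2 => M 0 j) kA; rewrite !mxE.
have [_ sol] := cauchy_solution_sum rho sp sm cp cm z c d (fin _ rho_lf) (fin _ sp_lf)
  (fin _ sm_lf) (fin _ cp_lf) (fin _ cm_lf) _ (index_enum 'I_3) (k 0) h
  (fun i => (ff1 i).1) (fun i => (ff1 i).2) ih ff1P.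
have fd0 : \sum_i k 0 i * (ff1 i).1 d = 0.
  by rewrite -[RHS](colA 0); apply: eq_bigr => i _; rewrite mxE.
have f1d0 : \sum_i k 0 i * (ff1 i).2 d = 0.
  by rewrite -[RHS](colA 1); apply: eq_bigr => i _; rewrite mxE.
pose w x := \sum_i k 0 i * e i x.
have hE : (fun x => \sum_i k 0 i * h i x) = cutoff c d w.
  by apply/funext => x; rewrite /h cutoff_lin.
have wz : defect z w by exact: defect_sum.
have L2w : L2 a b rho w by case: wz.
have L2cw := (L2_cutoff c d w oc od L2w).2.
rewrite hE in sol.
have Tw := T0_of_cauchy_solution a b rho sp sm cp cm z rho_lf sp_lf sm_lf
  c d (cutoff c d w) _ _ cd oc od L2cw (fun x => cutoff_out c d w x) sol fd0 f1d0.
have := wz.2 _ _ (Tmin_of_T0 _ _ Tw).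
(* The second component minus [z] times the first is the truncated [w], so [w] is orthogonal to its
   own truncation. *)
rewrite (eq_cint _ _ _ (fun x => w x * (cutoff c d w x)^*)); last first.
  by move=> x _; rewrite addrK.
move=> /(congr1 Re) /= int0.
pose phi x := Re (w x * (cutoff c d w x)^*).
have phiE x : phi x = if c <= x < d then sqn (w x) else 0.
  rewrite /phi /cutoff; case: ifPn => _; rewrite Re_mul Re_conjugate Im_conjugate.
    by rewrite mulrN opprK /sqn !expr2.
  by rewrite /= oppr0 !mulr0 subr0.
have phi0 x : 0 <= phi x by rewrite phiE; case: ifPn => // _; exact: sqn_ge0.
have [iphi _] : cintegrable rho (oitv a b) (fun x => w x * (cutoff c d w x)^*).
  exact: L2_cintegrable_conjM.
have : (\int[rho]_(x in oitv a b) `|(phi x)%:E| = 0)%E.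
  under eq_integral do rewrite gee0_abs ?lee_fin//.
  (* [fine] sends infinite values to 0; integrability of [phi] excludes them, so the extended
     integral vanishes as well. *)
  by rewrite -[LHS]fineK; [congr EFin|exact: integrable_fin_num].
move=> /(ae_eq_integral_abs rho mO (measurable_int _ iphi)).
apply: filterS => x /= phix cxd.
have ox : oitv a b x by apply: sub; rewrite /= in_itv.
by have [] := phix ox; rewrite -/(phi x) phiE cxd => /sqn_eq0.
Qed.
End defect_spaces.

(** * From local to global dependence, and counting dimensions *)

Section global_dependence.
Context {R : realType}.
Local Notation C := R[i].
Variables (a b : \bar R) (rho sp sm cp cm : {measure set R -> \bar R}).

Lemma oitv_rat_left (x : R) : oitv a b x -> exists q : rat, oitv a b (ratr q) /\ ratr q < x.
Proof.
move=> [ax xb].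
have [y [ay yx]] : exists y : R, (a <= y%:E)%E /\ y < x.
  case: a ax => [r| |] //= rx; first by exists r; rewrite lexx -lte_fin.
  by exists (x - 1); rewrite leNye ltrBlDr ltrDl.
have [q] := rat_in_itvoo yx; rewrite in_itv/= => /andP[yq qx].
exists q; split=> //; split; first by rewrite (le_lt_trans ay)// lte_fin.
by rewrite (lt_trans _ xb)// lte_fin.
Qed.

Lemma oitv_rat_right (x : R) : oitv a b x -> exists q : rat, oitv a b (ratr q) /\ x < ratr q.
Proof.
move=> [ax xb].
have [y [yb xy]] : exists y : R, (y%:E <= b)%E /\ x < y.
  case: b xb => [r| |] //= rx; first by exists r; rewrite lexx -lte_fin.
  by exists (x + 1); rewrite leey ltrDl.
have [q] := rat_in_itvoo xy; rewrite in_itv/= => /andP[xq qy].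
exists q; split=> //; split; first by rewrite (lt_trans ax)// lte_fin.
by rewrite (lt_le_trans _ yb)// lte_fin.
Qed.

(** Countably many intervals [q, r) with rational endpoints cover (a, b), and countable unions of
    null sets are null. *)
Lemma ae_oitv_of_local (W : R -> Prop) :
  (forall c d, oitv a b c -> oitv a b d -> c < d -> {ae rho, forall x, c <= x < d -> W x}) ->
  {ae rho, forall x, oitv a b x -> W x}.
Proof.
move=> loc.
(* Codes that decode to no pair, and pairs with an endpoint outside (a, b), impose no condition. *)
pose V n x := if unpickle n is Some (q, r) then
  oitv a b (ratr q) -> oitv a b (ratr r) -> ratr q <= x < ratr r -> W x else True.
have aeV n : {ae rho, forall x, V n x}.
  rewrite /V; case: (unpickle n) => [[q r]|]; last exact: aeW.
  have [[oq orr]|no] := pselect (oitv a b (ratr q) /\ oitv a b (ratr r)); last first.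
    by apply: aeW => x oq orr; exfalso; apply: no.
  have [qr|rq] := ltP (ratr q : R) (ratr r).
    by apply: filterS (loc _ _ oq orr qr) => x Wx _ _.
  by apply: aeW => x _ _ /andP[qx xr]; move: (lt_le_trans xr rq); rewrite ltNge qx.
apply: filterS (ae_foralln aeV) => x Vx ox.
have [q [oq qx]] := oitv_rat_left x ox; have [r [orr xr]] := oitv_rat_right x ox.
by have := Vx (pickle (q, r)); rewrite /V pickleK; apply => //; rewrite (ltW qx).
Qed.

Hypotheses (rho_lf : locfin a b rho).
Hypotheses (sp_lf : locfin a b sp) (sm_lf : locfin a b sm).
Hypotheses (cp_lf : locfin a b cp) (cm_lf : locfin a b cm).

(** Different intervals may give different coefficient vectors; [directed_subspaces_common] finds
    one that serves all of them. The points [c0 < d0] make the family inhabited. *)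
Lemma defect_dependent (z : C) (e : 'I_3 -> R -> C) (c0 d0 : R) :
  oitv a b c0 -> oitv a b d0 -> c0 < d0 ->
  (forall i, defect a b rho sp sm cp cm z (e i)) ->
  exists2 k : 'rV[C]_3, k != 0 & aeq a b rho (fun x => \sum_i k 0 i * e i x) (fun=> 0).
Proof.
move=> oc0 od0 cd0 ez.
pose I := {cd : R * R | [/\ oitv a b cd.1, oitv a b cd.2 & cd.1 < cd.2]}.
pose P (i : I) (v : 'rV[C]_3) :=
  {ae rho, forall x, (sval i).1 <= x < (sval i).2 -> \sum_j v 0 j * e j x = 0}.
have [k k0 kP] : exists2 v : 'rV[C]_3, v != 0 & forall i, P i v.
  apply: directed_subspaces_common; last exact: (exist _ (c0, d0) (And3 oc0 od0 cd0)).
  - by move=> i; apply: aeW => x _; rewrite big1// => j _; rewrite mxE mul0r.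
  - move=> i u v; apply: filterS2 => x ux vx cxd.
    under eq_bigr do rewrite mxE mulrDl.
    by rewrite big_split /= ux// vx// addr0.
  - move=> [[c d] [/= oc od cd]].
    have [v v0 vP] := defect_locally_dependent a b rho sp sm cp cm
      rho_lf sp_lf sm_lf cp_lf cm_lf z e c d ez oc od cd.
    by exists v.
  - move=> [[c d] [/= oc od cd]] [[c' d'] [/= oc' od' cd']].
    have om : oitv a b (Order.min c c') by rewrite minEle; case: ifP.
    have oM : oitv a b (Order.max d d') by rewrite maxEle; case: ifP.
    have mM : Order.min c c' < Order.max d d' by rewrite gt_min lt_max cd.
    (* The hull of two intervals contains both, so a relation valid on it restricts to each. *)
    exists (exist _ (Order.min c c', Order.max d d') (And3 om oM mM)) => v; rewrite /P/= => vP.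
    split; apply: filterS vP => x + /andP[cx xd]; apply;
      by rewrite ge_min lt_max ?cx ?xd ?orbT.
  - move=> i s u; apply: filterS => x ux cxd.
    under eq_bigr do rewrite mxE -mulrA.
    by rewrite -mulr_sumr ux// mulr0.
exists k => //; apply: ae_oitv_of_local => c d oc od cd.
exact: (kP (exist _ (c, d) (And3 oc od cd))).
Qed.

Definition L2free n (e : 'I_n -> R -> C) := forall k : 'I_n -> C,
  aeq a b rho (fun x => \sum_(i < n) k i * e i x) (fun=> 0) -> forall i, k i = 0.

(** Adjoining [u] in [S] as last member makes the family dependent. Independence of [e] forces a
    nonzero coefficient at [u], so the relation can be solved for [u]. *)
Lemma L2dim_of_maximal_free (S : (R -> C) -> Prop) n (e : 'I_n -> R -> C) :
  (forall i, S (e i)) -> L2free n e ->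
  (forall e' : 'I_n.+1 -> R -> C, (forall i, S (e' i)) -> ~ L2free n.+1 e') ->
  L2dim a b rho S n.
Proof.
move=> eS ef emax; exists e; split=> //; split=> // u uS.
pose e' (i : 'I_n.+1) := if unlift ord_max i is Some j then e j else u.
have e'S i : S (e' i) by rewrite /e'; case: unliftP.
have e'E (k : 'I_n.+1 -> C) x : \sum_i k i * e' i x =
    k ord_max * u x + \sum_(i < n) k (lift ord_max i) * e i x.
  rewrite (bigD1_ord ord_max)//= /e' unlift_none; congr (_ + _).
  by apply: eq_bigr => i _; rewrite liftK.
have [k kae [i ki]] : exists2 k : 'I_n.+1 -> C,
    aeq a b rho (fun x => \sum_i k i * e' i x) (fun=> 0) & exists i, k i <> 0.
  apply: contrapT => nk; apply: (emax e' e'S) => k kae i.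
  by apply: contrapT => ki; apply: nk; exists k => //; exists i.
have km : k ord_max != 0.
  apply/eqP => km; apply: ki.
  have k0 : forall j, k (lift ord_max j) = 0.
    apply: ef; apply: filterS kae => x kx ox; have := kx ox.
    by rewrite e'E km mul0r add0r.
  by case: (unliftP ord_max i) => [j|] ->.
exists (fun i => - (k (lift ord_max i) / k ord_max)).
apply: filterS kae => x kx ox; have := kx ox; rewrite e'E => /eqP.
rewrite addr_eq0 => /eqP kux.
apply: (mulfI km); rewrite kux mulr_sumr -sumrN; apply: eq_bigr => j _.
by rewrite mulrA mulrN mulrCA divff// mulr1 mulNr.
Qed.

(** The empty family is free and no triple is; the last size before free families first cease to
    exist is the dimension. *)
Lemma L2dim_le2 (S : (R -> C) -> Prop) :
  (forall e : 'I_3 -> R -> C, (forall i, S (e i)) -> ~ L2free 3 e) ->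
  exists n, (n <= 2)%N /\ L2dim a b rho S n.
Proof.
move=> S3.
pose free n := exists2 e : 'I_n -> R -> C, forall i, S (e i) & L2free n e.
have dim n : free n -> ~ free n.+1 -> L2dim a b rho S n.
  move=> [e eS ef] nf; apply: (L2dim_of_maximal_free S n e) => // e' e'S e'f.
  by apply: nf; exists e'.
have free0 : free 0%N by exists (fun _ _ => 0) => [[]|k _ []].
have [free1|nfree1] := pselect (free 1%N); last by exists 0%N; split=> //; exact: dim.
have [free2|nfree2] := pselect (free 2%N); last by exists 1%N; split=> //; exact: dim.
by exists 2%N; split=> //; apply: dim => // -[e eS]; exact: S3.
Qed.

Lemma defect_L2dim_le2 (z : C) (c0 d0 : R) :
  oitv a b c0 -> oitv a b d0 -> c0 < d0 ->
  exists n, (n <= 2)%N /\ L2dim a b rho (defect a b rho sp sm cp cm z) n.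
Proof.
move=> oc0 od0 cd0; apply: L2dim_le2 => e ez ef.
have [k /eqP k0 kae] := defect_dependent z e c0 d0 oc0 od0 cd0 ez.
by apply: k0; apply/rowP => i; rewrite mxE; exact: ef.
Qed.

End global_dependence.

(** * Complex conjugation and equality of the two indices *)

Section conjugation.
Context {R : realType}.
Local Notation C := R[i].
Local Notation Re := (@complex.Re R).
Local Notation Im := (@complex.Im R).
Implicit Types (m : {measure set R -> \bar R}) (D : set R) (f g u : R -> C) (z : C).

(** Holds for arbitrary [f]: if the positive or negative part has infinite integral, [fine] returns
    0 on both sides. Conjugation thus passes through [cint] unconditionally. *)
Lemma Rintegral_opp m D (f : R -> R) :
  \int[m]_(x in D) (- f x) = - \int[m]_(x in D) f x.
Proof.
rewrite /Rintegral; under eq_integral do rewrite EFinN.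
rewrite (integralE m D (fun x => - (f x)%:E)%E) (integralE m D (fun x => (f x)%:E)).
rewrite (funeposN (fun x => (f x)%:E)) (funenegN (fun x => (f x)%:E)).
have p0 : (0 <= \int[m]_(x in D) ((fun x => (f x)%:E)^\+ x))%E by exact: integral_ge0.
have n0 : (0 <= \int[m]_(x in D) ((fun x => (f x)%:E)^\- x))%E by exact: integral_ge0.
move: p0 n0; move: (integral _ _ _) (integral _ _ _) => [p| |] [q| |] //= _ _;
  by rewrite ?oppr0 ?opprB.
Qed.

Lemma cint_conj m D f : cint m D (fun x => (f x)^*) = (cint m D f)^*.
Proof.
rewrite [RHS]complexEta Re_conjugate Im_conjugate /cint /=; congr Complex.
  by apply: eq_Rintegral => x _ /=; rewrite Re_conjugate.
by rewrite -Rintegral_opp; apply: eq_Rintegral => x _ /=; rewrite Im_conjugate.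
Qed.

Lemma intc_conj m (c x : R) f : intc m c x (fun y => (f y)^*) = (intc m c x f)^*.
Proof.
by rewrite /intc; case: ifP => _; rewrite ?cint_conj//; case: ifP => _; rewrite ?rmorphN ?rmorph0.
Qed.

Lemma sintc_conj m m' (c x : R) f :
  sintc m m' c x (fun y => (f y)^*) = (sintc m m' c x f)^*.
Proof. by rewrite /sintc !intc_conj rmorphB. Qed.

Lemma conj_ReE f : Re \o (fun x => (f x)^*) = Re \o f.
Proof. by apply/funext => x /=; rewrite Re_conjugate. Qed.

Lemma conj_ImE f : Im \o (fun x => (f x)^*) = (fun x => - (Im \o f) x).
Proof. by apply/funext => x /=; rewrite Im_conjugate. Qed.

Lemma conj_sqnE f : sqn \o (fun x => (f x)^*) = sqn \o f.
Proof. by apply/funext => x /=; rewrite !sqnE Re_conjugate Im_conjugate sqrrN. Qed.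

Variables (a b : \bar R) (rho sp sm cp cm : {measure set R -> \bar R}).

Lemma locint_conj m f : locint a b m f -> locint a b m (fun x => (f x)^*).
Proof.
move=> fl c d oc od; have [rf jf] := fl c d oc od.
by rewrite conj_ReE conj_ImE; split=> //; exact: (integrableN jf).
Qed.

Lemma L2_conj f : L2 a b rho f -> L2 a b rho (fun x => (f x)^*).
Proof.
move=> [mR [mI fi]]; rewrite /L2 conj_ReE conj_ImE conj_sqnE; split=> //.
by split=> //; exact: measurable_funN.
Qed.

Lemma aeq_conj f g : aeq a b rho f g -> aeq a b rho (fun x => (f x)^*) (fun x => (g x)^*).
Proof. by apply: filterS => x fg ox; rewrite fg. Qed.

(** The coefficient measures are real, so conjugation commutes with every integral involved. *)
Lemma Dtau_conj f g : Dtau a b rho sp sm cp cm f g ->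
  Dtau a b rho sp sm cp cm (fun x => (f x)^*) (fun x => (g x)^*).
Proof.
move=> [h [F [[hp [hm [c [oc fE]]]] [[gl [c' [oc' FE]]] [c'' [oc'' [aep aem]]]]]]].
exists (fun x => (h x)^*), (fun x => (F x)^*); split; [|split].
- split; first exact: locint_conj.
  split; first exact: locint_conj.
  by exists c; split=> // x ox; rewrite fE// rmorphD sintc_conj.
- split; first exact: locint_conj.
  by exists c'; split=> // x ox; rewrite FE// rmorphD intc_conj.
- exists c''; split=> //; split; [apply: filterS aep|apply: filterS aem] => x Fx ox;
  by rewrite Fx// rmorphD rmorphN sintc_conj.
Qed.

Lemma T0_conj f g : T0 a b rho sp sm cp cm f g ->
  T0 a b rho sp sm cp cm (fun x => (f x)^*) (fun x => (g x)^*).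
Proof.
move=> [L2f [L2g [f0 [g0 [fg0 [[c [d [oc [od f00]]]] [ff0 gg0]]]]]]].
split; first exact: L2_conj.
split; first exact: L2_conj.
exists (fun x => (f0 x)^*), (fun x => (g0 x)^*); split; first exact: Dtau_conj.
split; last by split; exact: aeq_conj.
by exists c, d; split=> //; split=> // x ox nx; rewrite f00// rmorph0.
Qed.

Lemma Tmin_conj f g : Tmin a b rho sp sm cp cm f g ->
  Tmin a b rho sp sm cp cm (fun x => (f x)^*) (fun x => (g x)^*).
Proof.
move=> [L2f [L2g fgP]]; split; first exact: L2_conj.
split; first exact: L2_conj.
move=> e e0; have [f' [g' [fg' lee]]] := fgP e e0.
exists (fun x => (f' x)^*), (fun x => (g' x)^*); split; first exact: T0_conj.
have sqnB (u v : C) : sqn (u^* - v^*) = sqn (u - v).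
  by rewrite -rmorphB !sqnE Re_conjugate Im_conjugate sqrrN.
under eq_integral do rewrite sqnB.
by under [X in (_ + X)%E]eq_integral do rewrite sqnB.
Qed.

(** [Tmin] is invariant under conjugation, and pairing [u^*] with [g - z^* f] is the conjugate of
    pairing [u] with [g^* - z f^*]. *)
Lemma defect_conj z u : defect a b rho sp sm cp cm z u ->
  defect a b rho sp sm cp cm z^* (fun x => (u x)^*).
Proof.
move=> [L2u uP]; split; first exact: L2_conj.
move=> f g /Tmin_conj/uP /(congr1 Num.conj); rewrite rmorph0 -cint_conj => <-.
by apply: eq_cint => x _ /=; rewrite rmorphM /= conjCK rmorphB /= rmorphM /= conjCK.
Qed.

Lemma L2dim_defect_conj z n :
  L2dim a b rho (defect a b rho sp sm cp cm z) n ->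
  L2dim a b rho (defect a b rho sp sm cp cm z^*) n.
Proof.
have sumE (k : 'I_n -> C) (e : 'I_n -> R -> C) x :
    (\sum_(i < n) k i * e i x)^* = \sum_(i < n) (k i)^* * (e i x)^*.
  by rewrite rmorph_sum; apply: eq_bigr => i _; rewrite rmorphM.
move=> [e [eS [ef egen]]]; exists (fun i x => (e i x)^*); split.
  by move=> i; exact: defect_conj.
split.
  move=> k kae i; apply: (can_inj conjCK); rewrite rmorph0.
  apply: (ef (fun i => (k i)^*)); apply: filterS kae => x kx ox.
  have /(congr1 Num.conj) := kx ox; rewrite rmorph0 (sumE k (fun i x => (e i x)^*)) => kx0.
  by rewrite -[RHS]kx0; apply: eq_bigr => j _; rewrite conjCK.
(* Conjugation is an involution: [u^*] lies in the defect space at [z], and conjugating its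
   expansion gives one of [u]. *)
move=> u /defect_conj; rewrite conjCK => /egen[k uk].
exists (fun i => (k i)^*); apply: filterS uk => x ux ox.
by rewrite -sumE -ux// conjCK.
Qed.

End conjugation.

Theorem theorem4p9 (R : realType) (a b : \bar R) (hab : (a < b)%E)
  (rho sp sm cp cm : {measure set R -> \bar R})
  (H1 : locfin a b rho)
  (H2 : real_lfmeasure a b cp cm)
  (H3 : real_lfmeasure a b sp sm /\ forall x, oitv a b x -> in_supp_abs sp sm x)
  (H4 : forall x, oitv a b x ->
          ptmass sp sm x * ptmass cp cm x = 0 /\
          ptmass sp sm x * fine (rho [set x]) = 0)
  (H5 : forall al be, oitv a b al -> oitv a b be -> (al < be)%R ->
          in_supp rho al -> in_supp rho be ->
          (forall x, (al < x < be)%R -> ~ in_supp rho x) ->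
          forall f g, Dtau a b rho sp sm cp cm f g ->
            (@complex.Re R (f x)) @[x --> al^'-] --> 0 ->
            (@complex.Im R (f x)) @[x --> al^'-] --> 0 ->
            (@complex.Re R (f x)) @[x --> be^'+] --> 0 ->
            (@complex.Im R (f x)) @[x --> be^'+] --> 0 ->
            forall x, (al < x < be)%R -> f x = 0)
  (H6 : exists x y, x != y /\ oitv a b x /\ oitv a b y /\
          in_supp rho x /\ in_supp rho y) :
  exists n : nat, (n <= 2)%N /\
    L2dim a b rho (defect a b rho sp sm cp cm 'i) n /\
    L2dim a b rho (defect a b rho sp sm cp cm (- 'i)) n.
Proof.
(* The two distinct points of (H6), in increasing order, give the initial interval. *)
have [c [d [oc [od cd]]]] : exists c d, oitv a b c /\ oitv a b d /\ c < d.
  have [x [y [xy [ox [oy _]]]]] := H6.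
  by case: (ltgtP x y) xy => // [xy|yx] _; [exists x, y|exists y, x].
have [cp_lf [cm_lf _]] := H2; have [[sp_lf [sm_lf _]] _] := H3.
have [n [n2 dim]] := defect_L2dim_le2 a b rho sp sm cp cm H1 sp_lf sm_lf cp_lf cm_lf
  'i c d oc od cd.
exists n; split=> //; split=> //.
by rewrite -conjCi; exact: L2dim_defect_conj.
Qed.
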